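(* Let $A, B$ be rearrangement-invariant quasi-Banach function spaces over a non-atomic measure space $(\mathcal{R}, \mu)$, and let $\lVert \cdot \rVert_{\overline{A}}$, $\lVert \cdot \rVert_{\overline{B}}$ be the canonical representation quasinorms (over $([0,\infty),\lambda)$) of $\lVert\cdot\rVert_A$, $\lVert\cdot\rVert_B$. Then there are constants $0 < c \leq C < \infty$, depending only on the quasinorms $\lVert\cdot\rVert_A,\lVert\cdot\rVert_B$, such that for every $f \in \mathcal{M}(\mathcal{R}, \mu)$ $$c\,\lVert f^* \rVert_{\overline{A} + \overline{B}} \leq \lVert f \rVert_{A+B} \leq C\, \lVert f^* \rVert_{\overline{A} + \overline{B}}.$$ Furthermore, the functional $f \mapsto \lVert f^* \rVert_{\overline{A} + \overline{B}}$ on $\mathcal{M}(\mathcal{R},\mu)$ is a quasinorm, has the lattice property, is finite on $\chi_E$ for every measurable $E\subseteq\mathcal{R}$ with $\mu(E)<\infty$, and is rearrangement-invariant; and it has the local $L^1$ property if and only if $\lVert\cdot\rVert_{A+B}$ has the local $L^1$ property.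
   Context: Measure spaces are $\sigma$-finite. $\lambda$ is Lebesgue measure on $[0,\infty)$. $\mathcal{M}(\mathcal{R},\mu)$ is the set of ($\mu$-a.e. equivalence classes of) measurable functions on $\mathcal{R}$ (infinite values are allowed), and $\mathcal{M}_+$ its cone of non-negative functions. The non-increasing rearrangement of $f$ is $f^*(t)=\inf\{s\ge 0:\ \mu(\{|f|>s\})\le t\}$, $t\in[0,\infty)$. Properties of a functional $\lVert\cdot\rVert:\mathcal{M}(\mathcal{R},\mu)\to[0,\infty]$ with $\lVert\,|f|\,\rVert=\lVert f\rVert$: - quasinorm: $\lVert af\rVert=|a|\lVert f\rVert$ for $a\in\mathbb{C}$, $f \in \mathcal{M}_+$; $\lVert f\rVert=0\Leftrightarrow f=0$ a.e.; there is $K\ge1$ with $\lVert f+g\rVert\le K(\lVert f\rVert+\lVert g\rVert)$ for all $f,g\in\mathcal{M}_+$; - lattice property: $0\le f\le g$ a.e. implies $\lVert f\rVert\le\lVert g\rVert$; - Fatou property: $0\le f_n\uparrow f$ a.e. implies $\lVert f_n\rVert\uparrow\lVert f\rVert$; - finiteness on finite-measure sets: $\lVert\chi_E\rVert<\infty$ whenever $\mu(E)<\infty$; - local $L^1$ property: for every $E$ with $\mu(E)<\infty$ there is $C_E<\infty$ such that $\int_E f\,d\mu\le C_E\lVert f\rVert$ for all $f\in\mathcal{M}_+$; - rearrangement-invariance (r.i.): $\lVert f\rVert=\lVert g\rVert$ whenever $f^*=g^*$. An r.i. quasi-Banach function norm is such a functional that is a quasinorm, has the lattice and Fatou properties, is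 finite on finite-measure sets and is rearrangement-invariant; the corresponding r.i. quasi-Banach function space is $X=\{f\in\mathcal{M}(\mathcal{R},\mu):\lVert f\rVert_X<\infty\}$. Sum: for two such spaces $A,B$ over the same measure space, $A+B=\{f: \exists f_A\in A, f_B\in B,\ f=f_A+f_B\}$ and $\lVert f\rVert_{A+B}=\inf\{\lVert f_A\rVert_A+\lVert f_B\rVert_B:\ f=f_A+f_B,\ f_A\in A,\ f_B\in B\}$ (with $\inf\emptyset=\infty$). Canonical representation quasinorm (non-atomic case): fix a measure-preserving map $\sigma:\mathcal{R}\to[0,\mu(\mathcal{R}))$ and put, for $g\in\mathcal{M}([0,\infty),\lambda)$, $\lVert g\rVert_{\overline{X}}=\lVert (g^*\chi_{[0,\mu(\mathcal{R}))})\circ\sigma\rVert_X$; this does not depend on $\sigma$, it is an r.i. quasi-Banach function norm over $([0,\infty),\lambda)$, and $\lVert f\rVert_X=\lVert f^*\rVert_{\overline{X}}$ for all $f\in\mathcal{M}(\mathcal{R},\mu)$. $\overline{X}$ denotes the corresponding space. *)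

(* Defs.v *)
From HB Require Import structures.
From mathcomp Require Import all_boot all_order all_algebra.
From mathcomp Require Import complex.
From mathcomp Require Import all_classical all_reals all_analysis.
From mathcomp Require Import measurable_realfun.

Set Implicit Arguments.
Unset Strict Implicit.
Unset Printing Implicit Defensive.

Import Order.TTheory GRing.Theory Num.Theory.
Import numFieldNormedType.Exports.

Local Open Scope classical_set_scope.
Local Open Scope ring_scope.

(* The extended complex numbers C u {oo}; [None] is the point at infinity. *)
Definition xcomplex (R : realType) : Type := option R[i].

Section xcomplex_ops.
Context {R : realType}.
Implicit Types (z w : xcomplex R) (a : R[i]) (x : \bar R).

Definition xabs z : \bar R :=
  if z is Some u then (ComplexField.Normc.normc u)%:E else +oo%E.

(* oo + oo = oo; the value is immaterial below, since elements of quasi-Banach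
   function spaces are finite almost everywhere. *)
Definition xadd z w : xcomplex R :=
  if z is Some u then (if w is Some v then Some (u + v) else None) else None.

(* 0 * oo = 0, as for extended reals. *)
Definition xscale a z : xcomplex R :=
  if z is Some u then Some (a * u) else if a == 0 then Some 0 else None.

(* Meaningful on [0, +oo]. *)
Definition xreal x : xcomplex R :=
  if x is r%:E then Some (real_complex R r) else None.

End xcomplex_ops.

Section function_norms.
Context {R : realType} {d : measure_display} {T : measurableType d}.
Variable mu : {measure set T -> \bar R}.
Implicit Types (f g : T -> xcomplex R) (u v : T -> \bar R) (E F : set T).

(* Borel measurability into the Riemann sphere: the set where f is infinite is
   measurable, and the real and imaginary parts are measurable elsewhere. *)
Definition xmeasurable f : Prop :=
  [/\ measurable [set x | f x = None],
      measurable_fun setT (fun x => complex.Re (odflt 0 (f x))) &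
      measurable_fun setT (fun x => complex.Im (odflt 0 (f x)))].

Definition embed u : T -> xcomplex R := fun x => xreal (u x).

Definition nonneg_measurable u : Prop :=
  measurable_fun setT u /\ forall x, (0 <= u x)%E.

Definition rearrangement f (t : R) : \bar R :=
  ereal_inf [set s%:E%E | s in
    [set s : R | 0 <= s /\ (mu [set x | s%:E < xabs (f x)] <= t%:E)%E]].

Definition atom E : Prop :=
  [/\ measurable E, (0 < mu E)%E &
      forall F, measurable F -> F `<=` E -> mu F = 0%E \/ mu (E `\` F) = 0%E].

Definition non_atomic : Prop := forall E, ~ atom E.

Variable N : (T -> xcomplex R) -> \bar R.

(* N is a functional from the a.e. equivalence classes of measurable functions
   to [0, +oo] with N |f| = N f; its values at non-measurable functions carry
   no information. *)
Definition is_functional : Prop :=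
  [/\ forall f, xmeasurable f -> (0 <= N f)%E,
      forall f g, xmeasurable f -> xmeasurable g ->
        {ae mu, forall x, f x = g x} -> N f = N g &
      forall f, xmeasurable f -> N (embed (fun x => xabs (f x))) = N f].

Definition is_quasinorm : Prop :=
  [/\ forall (a : R[i]) u, nonneg_measurable u ->
        N (fun x => xscale a (embed u x))
        = ((ComplexField.Normc.normc a)%:E * N (embed u))%E,
      forall f, xmeasurable f ->
        (N f = 0%E <-> {ae mu, forall x, f x = Some 0}) &
      exists K : R, 1 <= K /\
        forall u v, nonneg_measurable u -> nonneg_measurable v ->
          (N (embed (fun x => u x + v x)%E)
             <= K%:E * (N (embed u) + N (embed v)))%E].

Definition lattice_property : Prop :=
  forall u v, measurable_fun setT u -> measurable_fun setT v ->
    {ae mu, forall x, (0 <= u x <= v x)%E} ->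
    (N (embed u) <= N (embed v))%E.

Definition Fatou_property : Prop :=
  forall (u_ : nat -> T -> \bar R) u,
    (forall n, measurable_fun setT (u_ n)) -> measurable_fun setT u ->
    {ae mu, forall x, [/\ forall n, (0 <= u_ n x)%E,
                          nondecreasing_seq (fun n => u_ n x) &
                          u_ n x @[n --> \oo] --> u x]} ->
    nondecreasing_seq (fun n => N (embed (u_ n))) /\
    N (embed (u_ n)) @[n --> \oo] --> N (embed u).

Definition finite_on_finite_measure : Prop :=
  forall E, measurable E -> (mu E < +oo)%E ->
    (N (embed (fun x => (\1_E x)%:E)) < +oo)%E.

Definition local_L1_property : Prop :=
  forall E, measurable E -> (mu E < +oo)%E ->
    exists C : R, forall u, nonneg_measurable u ->
      (\int[mu]_(x in E) u x <= C%:E * N (embed u))%E.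

Definition rearrangement_invariant : Prop :=
  forall f g, xmeasurable f -> xmeasurable g ->
    (forall t, 0 <= t -> rearrangement f t = rearrangement g t) -> N f = N g.

Definition ri_quasi_Banach_function_norm : Prop :=
  is_functional /\
  [/\ is_quasinorm, lattice_property, Fatou_property,
      finite_on_finite_measure & rearrangement_invariant].

Definition function_space : set (T -> xcomplex R) :=
  [set f | xmeasurable f /\ (N f < +oo)%E].

End function_norms.

Section sums.
Context {R : realType} {d : measure_display} {T : measurableType d}.
Variables (mu : {measure set T -> \bar R}) (NA NB : (T -> xcomplex R) -> \bar R).

Definition sum_norm (f : T -> xcomplex R) : \bar R :=
  ereal_inf [set y | exists fA fB : T -> xcomplex R,
    [/\ function_space NA fA, function_space NB fB,
        {ae mu, forall x, f x = xadd (fA x) (fB x)} &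
        y = (NA fA + NB fB)%E]].

End sums.

(* Lebesgue measure on [0, +oo): the half-line is represented by the Borel line
   with the negative reals as a null set. *)
Definition halfline_measure (R : realType) :
    {measure set (measurableTypeR R) -> \bar R} :=
  mrestr (@lebesgue_measure R)
    (measurable_itv `[0 : R, +oo[ : measurable (`[0, +oo[ : set R)).

Section representation.
Context {R : realType} {d : measure_display} {T : measurableType d}.
Variable mu : {measure set T -> \bar R}.

(* The interval [0, mu(T)), which is [0, +oo) when mu is infinite. *)
Definition measure_range : set R := [set t | 0 <= t /\ (t%:E < mu setT)%E].

Definition measure_preserving_onto_range (sigma : T -> measurableTypeR R) : Prop :=
  [/\ measurable_fun setT sigma, forall x, measure_range (sigma x) &
      forall E : set (measurableTypeR R), measurable E -> E `<=` measure_range ->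
        mu (sigma @^-1` E) = lebesgue_measure E].

Definition representation_norm (N : (T -> xcomplex R) -> \bar R)
    (sigma : T -> measurableTypeR R) (g : measurableTypeR R -> xcomplex R) : \bar R :=
  N (embed (fun x =>
    (rearrangement (halfline_measure R) g (sigma x)
       * (\1_measure_range (sigma x))%:E)%E)).

(* f |-> || f^* ||_{Abar + Bbar} *)
Definition rearranged_sum_norm (NA NB : (T -> xcomplex R) -> \bar R)
    (sA sB : T -> measurableTypeR R) (f : T -> xcomplex R) : \bar R :=
  sum_norm (halfline_measure R)
    (representation_norm NA sA) (representation_norm NB sB)
    (embed (rearrangement mu f : measurableTypeR R -> \bar R)).

End representation.

(* Main.v *)
(* The distribution function mu {|f| > s} determines an r.i. norm N monotonically:
   with a measure-preserving sigma, N f = N (f^* o sigma), and f^* is monotone in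
   the distribution function.  Moreover a bound mu {|w| > s} <= M mu {|v| > s}
   implies N w <= C N v with C depending only on M and on the quasinorm.

   If f = fA + fB, on the measure space or for f^* on the half-line, then
   mu {|f| > s} <= mu {2|fA| > s} + mu {2|fB| > s}.  Conversely, if
   mu {|f| > s} <= 2 (mu {vA > s} + mu {vB > s}), then on either side the function
   splits into two pieces with disjoint supports whose distribution functions are
   dominated by those of vA and vB, up to dilation and a factor.  Hence both sum
   norms are equivalent to the infimum of N_A vA + N_B vB over all such vA and vB
   on the measure space, and the quasi-triangle inequality, the vanishing and the
   finiteness of the second one are read off this description.  Its homogeneity
   and monotonicity are exact: any bound f^* <= |gA| + |gB| can be turned into a
   decomposition by cutting f^* at |gA|. *)

Require Import Defs.
From HB Require Import structures.
From mathcomp Require Import all_boot all_order all_algebra.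
From mathcomp Require Import complex.
From mathcomp Require Import all_classical all_reals all_analysis.
From mathcomp Require Import measurable_realfun.
From mathcomp Require Import zify.

Import Order.TTheory GRing.Theory Num.Theory.
Import numFieldNormedType.Exports.

Local Open Scope classical_set_scope.
Local Open Scope ring_scope.

(** * Measurable functions with extended complex values *)

Section extended_complex.
Context {R : realType}.
Implicit Types (z w : xcomplex R) (u : \bar R).

Lemma xabs_ge0 z : (0 <= xabs z)%E.
Proof. by case: z => [[a b]|] //=; rewrite lee_fin sqrtr_ge0. Qed.

Lemma xabs_xreal u : xabs (xreal u) = `|u|%E.
Proof.
by case: u => [r| |] //=; rewrite expr0n addr0 sqrtr_sqr.
Qed.

Lemma xabs_eq0 z : (xabs z = 0)%E -> z = Some 0.
Proof. by case: z => //= a [] /ComplexField.Normc.eq0_normc ->. Qed.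

Lemma xabs_xadd z w : (xabs (xadd z w) <= xabs z + xabs w)%E.
Proof.
case: z w => [a|] [b|] //=.
exact: (le_normcD (a : Rcomplex R) b).
Qed.

Lemma xadd0z z : xadd (Some 0) z = z.
Proof. by case: z => //= a; rewrite add0r. Qed.

Lemma xaddz0 z : xadd z (Some 0) = z.
Proof. by case: z => //= a; rewrite addr0. Qed.

Lemma xreal_add (x y : \bar R) : (0 <= x)%E -> (0 <= y)%E ->
  xadd (xreal x) (xreal y) = xreal (x + y)%E.
Proof.
case: x y => [r| |] [s| |] //= _ _; congr Some.
by rewrite -rmorphD.
Qed.

Lemma xabs_xscale (a : R[i]) z :
  xabs (xscale a z) = ((ComplexField.Normc.normc a)%:E * xabs z)%E.
Proof.
case: z => [b|] /=; first by rewrite ComplexField.Normc.normcM EFinM.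
case: eqP => [->|/eqP a0] /=; first by rewrite expr0n/= addr0 sqrtr0 mul0e.
rewrite gt0_muley// lte_fin lt_neqAle; apply/andP; split.
  by apply: contra a0 => /eqP/esym/ComplexField.Normc.eq0_normc ->.
by case: a {a0} => x y /=; rewrite sqrtr_ge0.
Qed.

End extended_complex.

Section measurability.
Context {R : realType} {d : measure_display} {T : measurableType d}.
Implicit Types (f g : T -> xcomplex R) (u v : T -> \bar R) (E F : set T).

Definition xrestrict F f : T -> xcomplex R :=
  fun x => if x \in F then f x else Some 0.

Lemma measurable_eqNone f : xmeasurable f ->
  measurable_fun setT (fun x => f x == None).
Proof.
move=> [mN _ _]; apply: (measurable_fun_bool true); rewrite setTI.
rewrite (_ : _ @^-1` _ = [set x | f x = None])//.
by apply/seteqP; split => x /= /eqP.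
Qed.

Lemma xmeasurable_xabs f : xmeasurable f ->
  measurable_fun setT (fun x => xabs (f x)).
Proof.
move=> [mN mRe mIm].
rewrite (_ : (fun x => xabs (f x)) = (fun x => if f x == None then +oo%E else
  (Num.sqrt (complex.Re (odflt 0 (f x)) ^+ 2 +
             complex.Im (odflt 0 (f x)) ^+ 2))%:E)); last first.
  by apply/funext => x; case: (f x) => [[a b]|].
apply: measurable_fun_ifT.
- exact: measurable_eqNone.
- exact: measurable_cst.
- apply/measurable_EFinP.
  pose g x : R := complex.Re (odflt 0 (f x)) ^+ 2 + complex.Im (odflt 0 (f x)) ^+ 2.
  rewrite (_ : (fun _ => _) = (@Num.sqrt R) \o g)//.
  apply: measurableT_comp.
    apply: nondecreasing_measurable => // x y xy; exact: ler_wsqrtr.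
  by apply: measurable_funD; apply: measurable_funX.
Qed.

Lemma xmeasurable_embed u : measurable_fun setT u -> xmeasurable (embed u).
Proof.
move=> mu; split.
- have -> : [set x | embed u x = None] = ~` (setT `&` [set x | u x \is a fin_num]).
    by rewrite setTI; apply/seteqP; split => x /=; rewrite /embed; case: (u x).
  by apply: measurableC; exact: emeasurable_fin_num.
- rewrite (_ : (fun _ => _) = fine \o u).
    apply: measurableT_comp => //; exact: fine_measurable.
  by apply/funext => x /=; rewrite /embed; case: (u x).
- rewrite (_ : (fun _ => _) = cst 0); first exact: measurable_cst.
  by apply/funext => x /=; rewrite /embed; case: (u x).
Qed.

Lemma measurable_mem F : measurable F -> measurable_fun setT (fun x : T => x \in F).
Proof.
move=> mF; apply: (measurable_fun_bool true); rewrite setTI.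
rewrite (_ : _ @^-1` _ = F)//.
by apply/seteqP; split => x /=; [move/set_mem|move/mem_set].
Qed.

Lemma xmeasurable_restrict F f :
  measurable F -> xmeasurable f -> xmeasurable (xrestrict F f).
Proof.
move=> mF [mN mRe mIm]; split.
- rewrite (_ : [set x | _] = F `&` [set x | f x = None]); first exact: measurableI.
  apply/seteqP; split => x /=; rewrite /xrestrict; first by case: ifPn => //; rewrite inE.
  by case=> Fx; rewrite ifT// inE.
- rewrite (_ : (fun _ => _) =
      (fun x => if x \in F then complex.Re (odflt 0 (f x)) else 0)); last first.
    by apply/funext => x; rewrite /xrestrict; case: ifP.
  by apply: measurable_fun_ifT => //; exact: measurable_mem.
- rewrite (_ : (fun _ => _) =
      (fun x => if x \in F then complex.Im (odflt 0 (f x)) else 0)); last first.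
    by apply/funext => x; rewrite /xrestrict; case: ifP.
  by apply: measurable_fun_ifT => //; exact: measurable_mem.
Qed.

Lemma xabs_restrict F f x :
  xabs (xrestrict F f x) = if x \in F then xabs (f x) else 0%E.
Proof.
by rewrite /xrestrict; case: ifP => //=; rewrite expr0n/= addr0 sqrtr0.
Qed.

Lemma xmeasurable_xscale (a : R[i]) f : xmeasurable f ->
  xmeasurable (fun x => xscale a (f x)).
Proof.
move=> [mN mRe mIm].
have aE x : odflt 0 (xscale a (f x)) = a * odflt 0 (f x).
  by case: (f x) => [b|] //=; case: eqP => [->|_] /=; rewrite ?mul0r ?mulr0.
split.
- have [a0|a0] := eqVneq a 0.
    rewrite (_ : [set x | _] = set0)//; apply/seteqP; split => x //=.
    by case: (f x) => [b|] //=; rewrite a0 eqxx.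
  rewrite (_ : [set x | _] = [set x | f x = None])//.
  by apply/seteqP; split => x /=; case: (f x) => [b|] //=; rewrite (negbTE a0).
- rewrite (_ : (fun _ => _) = (fun x => complex.Re a * complex.Re (odflt 0 (f x))
      - complex.Im a * complex.Im (odflt 0 (f x)))); last first.
    by apply/funext => x; rewrite aE; case: (a) (odflt 0 (f x)) => [? ?] [? ?].
  apply: measurable_funB; exact: measurable_funM.
- rewrite (_ : (fun _ => _) = (fun x => complex.Re a * complex.Im (odflt 0 (f x))
      + complex.Im a * complex.Re (odflt 0 (f x)))); last first.
    by apply/funext => x; rewrite aE; case: (a) (odflt 0 (f x)) => [? ?] [? ?].
  apply: measurable_funD; exact: measurable_funM.
Qed.

End measurability.

(** * Distribution functions and rearrangements *)

Section distribution.
Context {R : realType} {d : measure_display} {X : measurableType d}.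
Variable nu : {measure set X -> \bar R}.
Implicit Types (u v : X -> \bar R) (s t : R).

Definition distr u s : \bar R := nu [set x | (s%:E < u x)%E].

(** [rearrangement nu f] is convertible to [rearr nu (fun x => xabs (f x))]; later proofs pass
    between the two silently. *)
Definition rearr u t : \bar R :=
  ereal_inf [set s%:E%E | s in [set s : R | 0 <= s /\ (distr u s <= t%:E)%E]].

Lemma measurable_superlevel u (a : \bar R) : measurable_fun setT u ->
  measurable [set x | (a < u x)%E].
Proof.
by move=> mu; rewrite -[X in measurable X]setTI; exact: emeasurable_fun_o_infty.
Qed.

Lemma distr_ge0 u s : (0 <= distr u s)%E.
Proof. exact: measure_ge0. Qed.

Lemma distr_le_total u s : measurable_fun setT u -> (distr u s <= nu setT)%E.
Proof.
by move=> mu; apply: le_measure; rewrite ?inE//; exact: measurable_superlevel.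
Qed.

Lemma le_distr u v s : measurable_fun setT u -> measurable_fun setT v ->
  (forall x, (u x <= v x)%E) -> (distr u s <= distr v s)%E.
Proof.
move=> mu mv uv; apply: le_measure; rewrite ?inE; try exact: measurable_superlevel.
by move=> x /=; move=> /lt_le_trans; apply.
Qed.

Lemma distr_nonincreasing u s t : measurable_fun setT u -> s <= t ->
  (distr u t <= distr u s)%E.
Proof.
move=> mu st; apply: le_measure; rewrite ?inE; try exact: measurable_superlevel.
by move=> x /=; apply: le_lt_trans; rewrite lee_fin.
Qed.

(** Continuity of the measure from below: [{u > s}] is the increasing union of the sets
    [{u > s + 1/(n+1)}]. *)
Lemma distr_right_continuous u s (y : \bar R) : measurable_fun setT u ->
  (forall e, 0 < e -> (distr u (s + e) <= y)%E) -> (distr u s <= y)%E.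
Proof.
move=> mu uy; pose F n := [set x | ((s + n.+1%:R^-1)%:E < u x)%E].
have EF : [set x | (s%:E < u x)%E] = \bigcup_n F n.
  apply/seteqP; split => [x /= sx|x [n _]]; last first.
    by apply: lt_trans; rewrite lte_fin ltrDl invr_gt0.
  case ux : (u x) sx => [r| |//] sx.
    move: sx; rewrite lte_fin => /ltr_add_invr[k skr].
    by exists k => //=; rewrite /F/= ux lte_fin.
  by exists 0%N => //; rewrite /F/= ux ltry.
have mF n : measurable (F n) by exact: measurable_superlevel.
have : (nu \o F) x @[x --> \oo] --> nu (\bigcup_n F n).
  apply: nondecreasing_cvg_mu => //; first exact: bigcupT_measurable.
  move=> n m nm; apply/subsetPset => x; rewrite /F/=; apply: le_lt_trans.
  by rewrite lee_fin lerD2l lef_pV2 ?posrE// ler_nat ltnS.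
rewrite /distr EF => cF.
rewrite -(cvg_lim _ cF)//; apply: lime_le; first by apply/cvg_ex; eexists; exact: cF.
by apply: nearW => n; apply: uy; rewrite invr_gt0.
Qed.

(** Right continuity of [distr u] makes the infimum defining [rearr] a minimum when it is finite.
    Hence on the half-line [{rearr u > s}] is the segment [[0, distr u s)], the basis of all later
    computations with rearrangements. *)
Lemma lt_rearr u t s : measurable_fun setT u -> 0 <= s ->
  (s%:E < rearr u t)%E = (t%:E < distr u s)%E.
Proof.
move=> mu s0; rewrite !ltNge; congr negb; apply/idP/idP => [us|us].
  apply: distr_right_continuous => // e e0.
  have /ereal_inf_lt[_ [s' [s'0 us'] <-]] : (rearr u t < (s + e)%:E)%E.
    by rewrite (le_lt_trans us)// lte_fin ltrDl.
  by rewrite lte_fin => /ltW s's; rewrite (le_trans _ us')// distr_nonincreasing.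
by apply: ereal_inf_lbound; exists s.
Qed.

Lemma rearr_ge0 u t : (0 <= rearr u t)%E.
Proof. by apply/ereal_infP => _ [s [s0 _] <-]; rewrite lee_fin. Qed.

Lemma measurable_rearr u : measurable_fun setT u ->
  measurable_fun setT (rearr u : measurableTypeR R -> \bar R).
Proof.
move=> mu; apply: (measurability _ (ErealGenOInfty.measurableE R)).
move=> /= _ [_ [a ->]] <-; apply: measurableI => //.
have [a0|a0] := ltP a 0.
  rewrite [X in measurable X](_ : _ = setT)//; apply/seteqP; split => // x _ /=.
  by rewrite in_itv/= andbT (lt_le_trans _ (rearr_ge0 _ _)).
rewrite [X in measurable X](_ : _ = [set t | (t%:E < distr u a)%E]).
  by rewrite -[X in measurable X]setTI; apply: emeasurable_fun_infty_o => //;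
    exact: EFin_measurable.
by apply/seteqP; split => t /=; rewrite in_itv/= andbT lt_rearr.
Qed.

End distribution.

Section comparison.
Context {R : realType} {d : measure_display} {X : measurableType d}
  {d' : measure_display} {Y : measurableType d'}.
Variables (nu : {measure set X -> \bar R}) (nu' : {measure set Y -> \bar R}).

Lemma le_rearr (u : X -> \bar R) (v : Y -> \bar R) (t : R) :
  (forall s, 0 <= s -> (distr nu u s <= distr nu' v s)%E) ->
  (rearr nu u t <= rearr nu' v t)%E.
Proof.
move=> uv; apply: ereal_inf_le_tmp => _ [s [s0 vt] <-].
by exists s => //; split => //; exact: le_trans (uv _ s0) vt.
Qed.

Lemma eq_rearr (u : X -> \bar R) (v : Y -> \bar R) :
  (forall s, 0 <= s -> distr nu u s = distr nu' v s) -> rearr nu u = rearr nu' v.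
Proof.
move=> uv; apply/funext => t; rewrite /rearr; congr (ereal_inf _).
apply/seteqP; split => _ [s [s0 st] <-]; exists s => //; split => //.
  by rewrite -uv.
by rewrite uv.
Qed.

End comparison.

(** * Equimeasurability of a function with its rearrangement *)

Section equimeasurability.
Context {R : realType} {d : measure_display} {X : measurableType d}
  {d' : measure_display} {T : measurableType d'}.
Variables (nu : {measure set X -> \bar R}) (mu : {measure set T -> \bar R}).

Lemma lebesgue_measure_initial (D : \bar R) : (0 <= D)%E ->
  @lebesgue_measure R [set t | 0 <= t /\ (t%:E < D)%E] = D.
Proof.
case: D => [r| |//] r0.
- rewrite (_ : [set t | _] = `[0, r[%classic); last first.
    by apply/seteqP; split => t /=; rewrite in_itv/= lte_fin => /andP.
  rewrite lebesgue_measure_itv/= lte_fin; case: ifPn => [_|].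
    by rewrite oppr0 adde0.
  by rewrite -leNgt => r0'; apply/eqP; rewrite eq_le r0 lee_fin r0'.
- rewrite (_ : [set t | _] = `[0, +oo[%classic); last first.
    by apply/seteqP; split => t /=; rewrite in_itv/= andbT ltry; [case|move=> ->].
  by rewrite lebesgue_measure_itv/= ltry oppr0.
Qed.

Lemma distr_rearr_halfline (u : X -> \bar R) (s : R) :
  measurable_fun setT u -> 0 <= s ->
  distr (halfline_measure R) (rearr nu u) s = distr nu u s.
Proof.
move=> mu_ s0; rewrite -[RHS]lebesgue_measure_initial ?distr_ge0//.
rewrite /distr /halfline_measure /= /mrestr; congr lebesgue_measure.
by apply/seteqP; split => t /=; rewrite lt_rearr// in_itv/= andbT => -[].
Qed.

Lemma measurable_initial (D : \bar R) :
  measurable ([set t | 0 <= t /\ (t%:E < D)%E] : set R).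
Proof.
rewrite (_ : [set t | _] = `[0, +oo[ `&` [set t | (t%:E < D)%E]).
  apply: measurableI => //.
  by rewrite -[X in measurable X]setTI; apply: emeasurable_fun_infty_o => //;
    exact: EFin_measurable.
by apply/seteqP; split => t /=; rewrite in_itv/= andbT.
Qed.

(** Preservation of measure is assumed for subsets of [[0, mu T)] only, so the segment [[0, D)] is
    first cut at [mu T]; this produces the minimum. *)
Lemma measure_preserving_initial (sigma : T -> measurableTypeR R) (D : \bar R) :
  measure_preserving_onto_range mu sigma -> (0 <= D)%E ->
  mu [set x | ((sigma x)%:E < D)%E] = mine D (mu setT).
Proof.
move=> [msigma sigmaR sigmaP] D0.
have D0' : (0 <= mine D (mu setT))%E by rewrite le_min D0 measure_ge0.
rewrite -[RHS]lebesgue_measure_initial// -sigmaP.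
- congr (mu _); apply/seteqP; split => x /=; rewrite lt_min.
    by have [-> ->] := sigmaR x; rewrite andbT.
  by move=> [_ /andP[]].
- exact: measurable_initial.
- by move=> t /= [t0]; rewrite lt_min => /andP[_].
Qed.

Lemma distr_rearr_comp (sigma : T -> measurableTypeR R) (u : X -> \bar R) (s : R) :
  measure_preserving_onto_range mu sigma -> measurable_fun setT u -> 0 <= s ->
  distr mu (fun x => rearr nu u (sigma x)) s = mine (distr nu u s) (mu setT).
Proof.
move=> ms mu_ s0; rewrite -(measure_preserving_initial _ _ ms) ?distr_ge0//.
by congr (mu _); apply/seteqP; split => x /=; rewrite lt_rearr.
Qed.

Lemma measurable_rearr_comp (sigma : T -> measurableTypeR R) (u : X -> \bar R) :
  measure_preserving_onto_range mu sigma -> measurable_fun setT u ->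
  measurable_fun setT (fun x => rearr nu u (sigma x)).
Proof.
move=> [msigma _ _] mu_; apply: (measurableT_comp (measurable_rearr nu u mu_)) => //.
Qed.

End equimeasurability.

(** * Norms under a measure-preserving map *)

Section balanced_set.
Context {R : realType}.

Let shell (n : int) : set R := `[expR n%:~R, expR (n + 1)%:~R[%classic.

(** The shell has length [(e - 1) e^n], which is at least [e^n] since [e >= 2], and
    [e^n >= e^(-3) t]. *)
Let shell_meas (n : int) (t : R) : 0 < t -> expR (n + 3)%:~R >= t ->
  ((expR (-3) * t)%:E <= @lebesgue_measure R (shell n))%E.
Proof.
move=> t0 nt; rewrite lebesgue_measure_itv/= lte_fin ltr_expR ltr_int ltrDl ltr01.
rewrite -EFinD lee_fin (@le_trans _ _ (expR n%:~R))//.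
  rewrite -(ler_pM2l (expR_gt0 3)) mulrA -expRD subrr expR0 mul1r -expRD.
  by move: nt; rewrite intrD addrC.
rewrite intrD expRD lerBrDr -[X in X + X <= _]mulr1 -mulrDr ler_pM2l ?expR_gt0//.
by apply: expR_ge1Dx.
Qed.

(** [A] misses a whole shell inside [[0, t)], which by [shell_meas] carries at least the proportion
    [e^(-3)] of that interval. *)
Let complement_bound (A : set R) (n : int) (t : R) :
  measurable A -> 0 < t -> expR (n + 3)%:~R >= t ->
  expR (n + 1)%:~R <= t -> shell n `<=` ~` A ->
  (@lebesgue_measure R (A `&` `[0%R, t[) <= ((1 - expR (-3)) * t)%:E)%E.
Proof.
move=> mA t0 nt tn nA.
have mI : measurable (`[0, t[%classic : set R) by exact: measurable_itv.
have mS : measurable (shell n) by exact: measurable_itv.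
have St : shell n `<=` `[0, t[%classic.
  move=> x; rewrite /shell/= !in_itv/= => /andP[h1 h2].
  by rewrite (le_trans (expR_ge0 _) h1) (lt_le_trans h2).
have It : @lebesgue_measure R `[0, t[%classic = t%:E.
  by rewrite lebesgue_measure_itv/= lte_fin t0 oppr0 adde0.
apply: (@le_trans _ _ (@lebesgue_measure R (`[0, t[%classic `\` shell n))).
  apply: le_measure; rewrite ?inE; [exact: measurableI|exact: measurableD|].
  by move=> x [Ax xt]; split => // /nA.
rewrite measureD//; last by rewrite /= It ltry.
rewrite (_ : `[0, t[%classic `&` shell n = shell n); last exact: setIidr.
rewrite mulrBl mul1r EFinB; move: It => /= ->.
by apply: leeD2l; rewrite EFinN leeN2; exact: shell_meas.
Qed.

(* The union of every other shell [e^n, e^(n+1)): below any t, one of the two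
   consecutive shells preceding that of t lies in E and the other one does not. *)
Lemma exists_balanced_set : exists (E : set R) (q : R),
  [/\ measurable E, 0 < q < 1 & forall t, 0 <= t ->
    (@lebesgue_measure R (E `&` `[0%R, t[) <= (q * t)%:E)%E /\
    (@lebesgue_measure R (~` E `&` `[0%R, t[) <= (q * t)%:E)%E].
Proof.
pose E : set R := \bigcup_(k : int) shell (k * 2).
have mE : measurable E.
  by apply: countable_bigcupT_measurable => // k; exact: measurable_itv.
(* The index of a shell is determined by any of its points; this gives disjointness of the even and
   the odd shells. *)
have shellP (n : int) (t : R) : 0 < t -> shell n t <-> n = Num.floor (ln t).
  move=> t0; rewrite /shell/= in_itv/= -{1 2}(lnK t0) ler_expR ltr_expR.
  split => [h|->]; last exact: floor_itv.
  by apply/esym/floor_def.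
have shell_gt0 (n : int) (t : R) : shell n t -> 0 < t.
  by rewrite /shell/= in_itv/= => /andP[/(lt_le_trans (expR_gt0 _))].
have shell_even (k : int) : shell (k * 2) `<=` E by move=> x xk; exists k.
have shell_odd (k : int) : shell (k * 2 + 1) `<=` ~` E.
  move=> x xk [j _ xj]; have x0 := shell_gt0 _ _ xk.
  have := (shellP _ _ x0).1 xk. have := (shellP _ _ x0).1 xj.
  by move=> <-; lia.
have q0 : 0 < (1 - expR (-3) : R) < 1.
  by rewrite subr_gt0 expR_lt1 oppr_lt0 ltr0n/= ltrBlDr ltrDl expR_gt0.
exists E, (1 - expR (-3)); split => // t; rewrite le_eqVlt => /predU1P[<-|t0].
  by rewrite set_itvco0 !setI0 measure0 mulr0.
have nt : t < expR (Num.floor (ln t) + 1)%:~R.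
  by rewrite -{1}(lnK t0) ltr_expR; have /andP[] := floor_itv (ln t).
have tn : expR (Num.floor (ln t))%:~R <= t.
  by rewrite -[leRHS](lnK t0) ler_expR; have /andP[] := floor_itv (ln t).
(* Let m be the floor of [ln t]. The shells m-1 and m-2 lie below t and have indices of opposite
   parity, so one is in [E] and the other in its complement. As [t < e^(m+1)], the lower of them
   accounts for the exponent 3. *)
have [k [e1|e1]] : exists k : int, Num.floor (ln t) - 1 = k * 2 \/
   Num.floor (ln t) - 1 = k * 2 + 1.
  by exists ((Num.floor (ln t) - 1) %/ 2)%Z; lia.
- split.
  + apply: (@complement_bound _ (k * 2 - 1)) => //.
    * rewrite (le_trans (ltW nt))// ler_expR ler_int; lia.
    * rewrite (le_trans _ tn)// ler_expR ler_int; lia.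
    * by rewrite (_ : k * 2 - 1 = (k - 1) * 2 + 1); [exact: shell_odd|lia].
  + apply: (@complement_bound _ (k * 2)) => //.
    * exact: measurableC.
    * rewrite (le_trans (ltW nt))// ler_expR ler_int; lia.
    * rewrite (le_trans _ tn)// ler_expR ler_int; lia.
    * by rewrite setCK.
- split.
  + apply: (@complement_bound _ (k * 2 + 1)) => //.
    * rewrite (le_trans (ltW nt))// ler_expR ler_int; lia.
    * rewrite (le_trans _ tn)// ler_expR ler_int; lia.
  + apply: (@complement_bound _ (k * 2)) => //.
    * exact: measurableC.
    * rewrite (le_trans (ltW nt))// ler_expR ler_int; lia.
    * rewrite (le_trans _ tn)// ler_expR ler_int; lia.
    * by rewrite setCK.
Qed.

End balanced_set.

(** * Monotonicity and dilation for a single rearrangement-invariant norm *)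

Section norm.
Context {R : realType} {d : measure_display} {T : measurableType d}.
Variables (mu : {measure set T -> \bar R}) (N : (T -> xcomplex R) -> \bar R).
Hypothesis HN : ri_quasi_Banach_function_norm mu N.
Implicit Types (u v w : T -> \bar R) (sigma : T -> measurableTypeR R).

Lemma nonneg_measurable_rearr_comp {d'} {X : measurableType d'}
    (nu : {measure set X -> \bar R}) sigma (u : X -> \bar R) :
  measure_preserving_onto_range mu sigma -> measurable_fun setT u ->
  nonneg_measurable (fun x => rearr nu u (sigma x)).
Proof.
move=> ms mu_; split; first exact: measurable_rearr_comp ms mu_.
by move=> x; exact: rearr_ge0.
Qed.

Lemma rearrangement_embed {d'} {X : measurableType d'}
    (nu : {measure set X -> \bar R}) (u : X -> \bar R) : (forall x, (0 <= u x)%E) ->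
  rearrangement nu (embed u) = rearr nu u.
Proof.
move=> u0; rewrite (_ : u = (fun x => xabs (embed u x)))//.
  rewrite [in LHS](_ : embed _ = embed u)//.
  by congr embed; apply/funext => x; rewrite xabs_xreal gee0_abs.
by apply/funext => x; rewrite xabs_xreal gee0_abs.
Qed.

Lemma norm_ge0 u : nonneg_measurable u -> (0 <= N (embed u))%E.
Proof. by move: HN => [[N0 _ _] _] [mu_ _]; apply: N0; exact: xmeasurable_embed. Qed.

Lemma norm0 : N (embed (cst 0%E)) = 0%E.
Proof.
move: HN => [_ [[_ N0 _] _ _ _ _]].
by apply/(N0 _ (xmeasurable_embed (cst 0%E) (measurable_cst _))); exact: aeW.
Qed.

Lemma norm_scale (r : R) u : 0 < r -> nonneg_measurable u ->
  N (embed (fun x => r%:E * u x)%E) = (r%:E * N (embed u))%E.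
Proof.
move: HN => [_ [[NZ _ _] _ _ _ _]] r0 mu_.
have := NZ (real_complex R r) u mu_.
rewrite /= expr0n addr0 sqrtr_sqr gtr0_norm// => <-; congr N.
apply/funext => x; rewrite /embed; have := mu_.2 x; case: (u x) => [s| |]//= _.
  by congr Some; rewrite -rmorphM.
rewrite gt0_muley ?lte_fin// ifF//.
by apply/negbTE; rewrite eq_complex/= eqxx andbT gt_eqF.
Qed.

(** Both functions have the same distribution: the cut at [mu T] in [distr_rearr_comp] leaves
    [distr mu u] unchanged, since it never exceeds [mu T]. *)
Lemma norm_rearr sigma u : measure_preserving_onto_range mu sigma ->
  nonneg_measurable u ->
  N (embed u) = N (embed (fun x => rearr mu u (sigma x))).
Proof.
move: HN => [_ [_ _ _ _ NR]] ms [mu_ u0].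
have mr := measurable_rearr_comp mu mu sigma u ms mu_.
apply: NR; [exact: xmeasurable_embed|exact: xmeasurable_embed|].
move=> t _; rewrite !rearrangement_embed//; last by move=> x; exact: rearr_ge0.
congr (_ t); apply: eq_rearr => s s0.
by rewrite distr_rearr_comp// min_l// distr_le_total.
Qed.

(** Composed with the same [sigma], the two rearrangements compare pointwise, and the lattice
    property applies. *)
Lemma norm_le_distr sigma u v : measure_preserving_onto_range mu sigma ->
  nonneg_measurable u -> nonneg_measurable v ->
  (forall s, 0 <= s -> (distr mu u s <= distr mu v s)%E) ->
  (N (embed u) <= N (embed v))%E.
Proof.
move=> ms mu_ mv uv; rewrite (norm_rearr _ _ ms mu_) (norm_rearr _ _ ms mv).
move: HN => [_ [_ NL _ _ _]]; apply: NL.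
- exact: (measurable_rearr_comp _ _ _ _ ms mu_.1).
- exact: (measurable_rearr_comp _ _ _ _ ms mv.1).
- by apply: aeW => x; rewrite rearr_ge0 le_rearr.
Qed.

(** With [D = distr mu w s], the superlevel set of the restricted function lies in the preimage of
    the part of [E] in [[0, D)]. Its measure is at most [q D], which gains the factor [q] over the
    bound for [w]. *)
Lemma dilation_step sigma (c q : R) (E : set R) :
  measure_preserving_onto_range mu sigma -> measurable E -> 0 < q -> 0 < c ->
  (forall t, 0 <= t ->
    (@lebesgue_measure R (E `&` `[0%R, t[) <= (q * t)%:E)%E) ->
  forall w v, nonneg_measurable w -> nonneg_measurable v ->
  (forall s, 0 <= s -> (distr mu w s <= (c / q)%:E * distr mu v s)%E) ->
  forall s, 0 <= s ->
  (distr mu (fun x => if sigma x \in E then rearr mu w (sigma x) else 0) s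
    <= c%:E * distr mu v s)%E.
Proof.
move=> ms mE q0 c0 Eq w v mw mv wv s s0.
have [->|dv] := eqVneq (distr mu v s) +oo%E.
  by rewrite gt0_muley ?lte_fin// leey.
have dv0 := distr_ge0 mu v s.
have dvf : distr mu v s \is a fin_num by rewrite ge0_fin_numE// ltey.
have dwf : distr mu w s \is a fin_num.
  rewrite ge0_fin_numE ?distr_ge0// (le_lt_trans (wv _ s0))//.
  by rewrite -(fineK dvf) -EFinM ltry.
have := wv _ s0; rewrite -(fineK dvf) -(fineK dwf) -!EFinM lee_fin => wv'.
set D := fine (distr mu w s) in wv'.
have D0 : 0 <= D by apply: fine_ge0; exact: distr_ge0.
have [msigma sigmaR sigmaP] := ms.
(* The cut at [mu T] places [A] in the range of [sigma], where measures are preserved. *)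
pose A := E `&` [set t | 0 <= t /\ (t%:E < mine D%:E (mu setT))%E].
have mA : measurable A by apply: measurableI => //; exact: measurable_initial.
apply: (@le_trans _ _ (mu (sigma @^-1` A))).
  apply: le_measure; rewrite ?inE.
  - apply: measurable_superlevel; apply: measurable_fun_ifT => //.
    + apply: (measurableT_comp (measurable_mem E mE)) => //.
    + exact: (measurable_rearr_comp _ _ _ _ ms mw.1).
  - by rewrite -[X in measurable X]setTI; exact: msigma.
  - move=> x /=; case: ifPn => [/set_mem xE|_]; last by rewrite lte_fin ltNge s0.
    rewrite lt_rearr//; last exact: mw.1.
    rewrite -(fineK dwf) => xD; split => //; split; first by have [] := sigmaR x.
    by rewrite lt_min xD; have [] := sigmaR x.
rewrite sigmaP//; last by move=> t [_ [t0]]; rewrite lt_min => /andP[].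
apply: (@le_trans _ _ (@lebesgue_measure R (E `&` `[0%R, D[))).
  apply: le_measure; rewrite ?inE//; first exact: measurableI.
  move=> t [Et [t0]]; rewrite lt_min lte_fin => /andP[tD _]; split => //=.
  by rewrite in_itv/= t0.
apply: (le_trans (Eq _ D0)); rewrite lee_fin.
apply: (@le_trans _ _ (q * (c / q * fine (distr mu v s)))); first by rewrite ler_pM2l.
by rewrite mulrA (mulrC q) divfK// gt_eqF.
Qed.

(* A distribution function bounded by a multiple of another one costs only a
   constant: one splits w along a balanced set, which divides the multiple by a
   fixed factor greater than 1, and iterates. *)
Lemma dilation (M : R) : exists2 C : R, 0 < C &
  forall sigma, measure_preserving_onto_range mu sigma ->
  forall w v, nonneg_measurable w -> nonneg_measurable v ->
  (forall s, 0 <= s -> (distr mu w s <= M%:E * distr mu v s)%E) ->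
  (N (embed w) <= C%:E * N (embed v))%E.
Proof.
have [E [q [mE /andP[q0 q1] Eq]]] := @exists_balanced_set R.
have [K [K1 NK]] : exists K : R, 1 <= K /\
    forall u v, nonneg_measurable u -> nonneg_measurable v ->
    (N (embed (fun x => u x + v x)%E) <= K%:E * (N (embed u) + N (embed v)))%E.
  by move: HN => [_ [[_ _ ?] _ _ _ _]].
have K0 : 0 < K by rewrite (lt_le_trans _ K1).
(* Each factor [1/q] in the distribution bound is traded for a factor [2 K] in the norm bound: two
   pieces, and one use of the quasi-triangle inequality. *)
have iter k : forall sigma, measure_preserving_onto_range mu sigma ->
  forall w v, nonneg_measurable w -> nonneg_measurable v ->
  (forall s, 0 <= s -> (distr mu w s <= (q ^- k)%:E * distr mu v s)%E) ->
  (N (embed w) <= ((K * 2) ^+ k)%:E * N (embed v))%E.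
  elim: k => [|k IH] sigma ms w v mw mv wv.
    rewrite expr0 mul1e; apply: (norm_le_distr sigma) => // s s0.
    by have := wv _ s0; rewrite expr0 invr1 mul1e.
  have qk : 0 < q ^- k by rewrite invr_gt0 exprn_gt0.
  have wv' s : 0 <= s -> (distr mu w s <= (q ^- k / q)%:E * distr mu v s)%E.
    by move=> s0; have := wv _ s0; rewrite exprSr invfM mulrC.
  (* The rearranged copy of [w] on T, not [w] itself, is divided along the balanced set and its
     complement. *)
  pose w1 x := (if sigma x \in E then rearr mu w (sigma x) else 0)%E.
  pose w2 x := (if sigma x \in ~` E then rearr mu w (sigma x) else 0)%E.
  have mw1 (F : set R) : measurable F -> nonneg_measurable
      (fun x => if sigma x \in F then rearr mu w (sigma x) else 0)%E.
    move=> mF; split; last by move=> x; case: ifP => // _; exact: rearr_ge0.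
    apply: measurable_fun_ifT => //.
      by apply: (measurableT_comp (measurable_mem F mF)) => //; case: ms.
    exact: (measurable_rearr_comp _ _ _ _ ms mw.1).
  have Nw1 : (N (embed w1) <= ((K * 2) ^+ k)%:E * N (embed v))%E.
    apply: (IH sigma) => //; first exact: mw1.
    apply: (dilation_step _ _ _ _ ms mE q0 qk) wv' => // t t0.
    by have [] := Eq t t0.
  have mCE : measurable (~` E) by exact: measurableC.
  have Nw2 : (N (embed w2) <= ((K * 2) ^+ k)%:E * N (embed v))%E.
    apply: (IH sigma) => //; first exact: mw1.
    apply: (dilation_step _ _ _ _ ms mCE q0 qk) wv' => // t t0.
    by have [] := Eq t t0.
  rewrite (norm_rearr _ _ ms mw).
  rewrite (_ : (fun x => _) = (fun x => w1 x + w2 x)%E); last first.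
    apply/funext => x; rewrite /w1 /w2 in_setC.
    by case: (sigma x \in E); rewrite ?adde0 ?add0e.
  apply: (le_trans (NK _ _ (mw1 _ mE) (mw1 _ mCE))).
  rewrite exprS EFinM -muleA EFinM -muleA lee_pmul2l ?lte_fin//.
  by rewrite mule_natl mule2n leeD.
(* The number of rounds depends only on [M] and [q], so the final constant does not involve [sigma],
   [w] or [v]. *)
have [k Mk] : exists k, M <= q ^- k.
  have M1 : 0 < `|M| + 1 by rewrite ltr_pwDr.
  have qk0 : (fun k => q ^+ k) @ \oo --> (0 : R).
    by apply: cvg_expr; rewrite gtr0_norm.
  have M1' : 0 < (`|M| + 1)^-1 by rewrite invr_gt0.
  have [k _ /(_ k (leqnn k))/= /ltW qM] := cvgr_lt _ qk0 _ M1'.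
  exists k; rewrite -[M]invrK; move: qM.
  rewrite -[X in X <= _]invrK lef_pV2 ?posrE ?invr_gt0 ?exprn_gt0//.
  by rewrite invrK; apply: le_trans; rewrite (le_trans (ler_norm _))// lerDl.
exists ((K * 2) ^+ k); first by rewrite exprn_gt0// mulr_gt0.
move=> sigma ms w v mw mv wv; apply: (iter k sigma) => // s s0.
by rewrite (le_trans (wv _ s0))// lee_wpmul2r ?lee_fin ?distr_ge0.
Qed.

Section halfline.
Variable sigma : T -> measurableTypeR R.
Hypothesis ms : measure_preserving_onto_range mu sigma.

Lemma representation_normE (g : measurableTypeR R -> xcomplex R) :
  representation_norm mu N sigma g =
  N (embed (fun x => rearr (halfline_measure R) (fun t => xabs (g t)) (sigma x))).
Proof.
rewrite /representation_norm; congr (N (embed _)); apply/funext => x.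
rewrite indicE mem_set ?mule1//; last by case: ms.
Qed.

End halfline.
End norm.

(** * Splitting a function along its distribution *)

Section splitting.
Context {R : realType} {d : measure_display} {X : measurableType d}.
Variable nu : {measure set X -> \bar R}.
Variable G : X -> \bar R.
Hypothesis mG : nonneg_measurable G.

(** [Q] marks the scales [e^m] at which [H] controls [G]. Round s down to [e^n] and take the least
    marked m with [m >= n]: every point of [A] with [G > s] then has [G > e^m], so the measure is at
    most [2 H(e^m) <= 2 H(e^n)], and [e^n >= s/e]. If no such m exists, there are no such points. *)
Lemma distr_restrict_le (A : set X) (Q : int -> bool) (H : R -> \bar R) :
  measurable A ->
  (forall s t : R, 0 < s -> s <= t -> (H t <= H s)%E) ->
  (forall s : R, 0 < s -> (0 <= H s)%E) ->
  (forall m, Q m -> (distr nu G (expR m%:~R) <= 2%:E * H (expR m%:~R))%E) ->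
  (forall x n, A x -> ((expR n%:~R)%:E < G x)%E ->
    exists m, [/\ n <= m, Q m & ((expR m%:~R)%:E < G x)%E]) ->
  forall s : R, 0 < s ->
  (nu (A `&` [set x | (s%:E < G x)%E]) <= 2%:E * H (expR (-1) * s)%R)%E.
Proof.
move=> mA HH H0 GH AQ s s0; pose n := Num.floor (ln s).
have ns : expR n%:~R <= s.
  by rewrite -[leRHS](lnK s0) ler_expR; have /andP[] := floor_itv (ln s).
have sn : expR (-1) * s <= expR n%:~R.
  rewrite -(ler_pM2l (expR_gt0 1)) mulrA -expRD subrr expR0 mul1r -expRD.
  rewrite -{1}(lnK s0) ler_expR addrC; apply: ltW.
  by have /andP[_] := floor_itv (ln s); rewrite intrD.
apply: (@le_trans _ _ (2%:E * H (expR n%:~R))%E); last first.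
  by rewrite lee_pmul2l// HH// mulr_gt0// expR_gt0.
have mGs (a : R) : measurable [set x | (a%:E < G x)%E].
  by apply: measurable_superlevel; case: mG.
have [[k Qk]|nQ] := pselect (exists k : nat, Q (n + k%:Z)); last first.
  rewrite (_ : A `&` _ = set0) ?measure0 ?mule_ge0 ?H0 ?expR_gt0//.
  apply/seteqP; split => // x [Ax /= sx]; apply: nQ.
  have [|m [nm Qm _]] := AQ x n Ax; first by rewrite (le_lt_trans _ sx)// lee_fin.
  by exists `|m - n|%N; rewrite gez0_abs ?subr_ge0// subrKC.
have [k' Qk' k'min] := ex_minnP (ex_intro (fun k : nat => Q (n + k%:Z)) k Qk).
apply: (@le_trans _ _ (distr nu G (expR (n + k'%:Z)%:~R))).
  apply: le_measure; rewrite ?inE//; first exact: measurableI.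
  move=> x [Ax /= sx].
  have [|m [nm Qm xm]] := AQ x n Ax; first by rewrite (le_lt_trans _ sx)// lee_fin.
  apply: le_lt_trans xm; rewrite lee_fin ler_expR ler_int.
  have := k'min `|m - n|%N; rewrite gez0_abs ?subr_ge0// subrKC => /(_ Qm).
  by lia.
apply: (le_trans (GH _ Qk')); rewrite lee_pmul2l// HH ?expR_gt0// ler_expR ler_int.
by lia.
Qed.

(* X is cut along the shells e^n < G <= e^(n+1), each shell going to the summand
   that is larger at e^n; the set where G is infinite goes where infinitely many
   of the upper shells go. *)
Lemma distr_splitting (H K : R -> \bar R) :
  (forall s t : R, 0 < s -> s <= t -> (H t <= H s)%E) ->
  (forall s t : R, 0 < s -> s <= t -> (K t <= K s)%E) ->
  (forall s : R, 0 < s -> (0 <= H s)%E) -> (forall s : R, 0 < s -> (0 <= K s)%E) ->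
  (forall s : R, 0 < s -> (distr nu G s <= H s + K s)%E) ->
  exists F : set X, [/\ measurable F,
    forall s : R, 0 < s ->
      (nu (F `&` [set x | (s%:E < G x)%E]) <= 2%:E * H (expR (-1) * s)%R)%E &
    forall s : R, 0 < s ->
      (nu (~` F `&` [set x | (s%:E < G x)%E]) <= 2%:E * K (expR (-1) * s)%R)%E].
Proof.
move=> HH KK H0 K0 GHK; have [mG' G0] := mG.
(* At the scales in [P] the bound [H + K] is at most [2 H], at the others at most [2 K]. *)
pose P (n : int) := (K (expR n%:~R) <= H (expR n%:~R))%E.
pose unbounded := forall n : int, exists m, n <= m /\ P m.
pose shell (n : int) :=
  [set x | ((expR n%:~R)%:E < G x)%E /\ (G x <= (expR (n + 1)%:~R)%:E)%E].
pose F := (\bigcup_n [set x | P n /\ shell n x]) `|` [set x | unbounded /\ G x = +oo%E].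
have mF : measurable F.
  apply: measurableU.
    apply: countable_bigcupT_measurable => // n.
    have [Pn|nPn] := boolP (P n); last first.
      by rewrite (_ : [set x | _] = set0)//; apply/seteqP; split => x //= [].
    rewrite (_ : [set x | _] = [set x | ((expR n%:~R)%:E < G x)%E] `&`
       (setT `&` [set x | (G x <= (expR (n + 1)%:~R)%:E)%E])).
      apply: measurableI; first exact: measurable_superlevel.
      exact: emeasurable_fun_infty_c.
    by rewrite setTI; apply/seteqP; split => x /=; [case|].
  have [ub|nub] := pselect unbounded; last first.
    by rewrite (_ : [set x | _] = set0)//; apply/seteqP; split => x //= [].
  rewrite (_ : [set x | _] = setT `&` (G @^-1` [set +oo%E])).
    exact: mG'.
  by rewrite setTI; apply/seteqP; split => x /=; [case|].
have double (x y : \bar R) : (y <= x)%E -> (x + y <= 2%:E * x)%E.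
  by move=> yx; rewrite mule_natl mule2n leeD2l.
have shell_le n j x : ((expR n%:~R)%:E < G x)%E -> shell j x -> n <= j.
  move=> nx [_ xj]; have := lt_le_trans nx xj.
  by rewrite lte_fin ltr_expR ltr_int; lia.
exists F; split => //.
- apply: (@distr_restrict_le F P) => //.
    by move=> m Pm; rewrite (le_trans (GHK _ (expR_gt0 _)))// double.
  move=> x n [[j _ [Pj xj]]|[ub xy]] nx.
    by exists j; split => //; [exact: shell_le nx xj|case: xj].
  by have [m [nm Pm]] := ub n; exists m; split => //; rewrite xy ltry.
- apply: (@distr_restrict_le (~` F) (fun n => ~~ P n)) => //.
  + exact: measurableC.
  + move=> m; rewrite -ltNge => /ltW Pm.
    by rewrite (le_trans (GHK _ (expR_gt0 _)))// addeC double.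
  move=> x n nFx nx; case xr : (G x) (G0 x) nx => [r| |//] r0 nx.
    have {}r0 : 0 < r by move: nx; rewrite lte_fin; apply: lt_trans; exact: expR_gt0.
    (* The shells are open below and closed above, hence the ceiling minus one rather than the
       floor. *)
    pose j := Num.ceil (ln r) - 1.
    have xj : shell j x.
      rewrite /shell/= xr lte_fin lee_fin -(lnK r0) ltr_expR ler_expR.
      have /andP[h1 h2] := ceil_itv (ln r).
      by rewrite /j subrK h2; split => //; move: h1.
    exists j; split; [|by apply/negP => Pj; apply: nFx; left; exists j|].
      by apply: (shell_le _ _ x) => //; rewrite xr.
    by rewrite -xr; case: xj.
  (* Here [G x] is infinite and x is outside [F], so [P] fails at every scale from some [n0] on; any
     of them beyond n will do. *)
  have /existsNP[n0 nn0] : ~ unbounded by move=> ub; apply: nFx; right.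
  exists (Num.max n n0); split; [by rewrite le_max lexx| |exact: ltry].
  by apply/negP => Pm; apply: nn0; exists (Num.max n n0); rewrite le_max lexx orbT.
Qed.

End splitting.

(** * Equivalence of the two sum norms *)

Lemma le_EFinM {R : realType} (C C' : R) (y y' z : \bar R) : 0 < C -> C <= C' ->
  (0 <= y')%E -> (y <= C%:E * y')%E -> (y <= C'%:E * y')%E.
Proof.
by move=> C0 CC' y0 yy'; rewrite (le_trans yy')// lee_wpmul2r// lee_fin.
Qed.

Section distribution_of_sums.
Context {R : realType} {d : measure_display} {X : measurableType d}.
Variable nu : {measure set X -> \bar R}.
Implicit Types (u v : X -> \bar R).

Lemma nonneg_measurable_scale (r : R) u : 0 < r ->
  nonneg_measurable u -> nonneg_measurable (fun x => r%:E * u x)%E.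
Proof.
move=> r0 [mu u0]; split; first exact: measurable_funeM.
by move=> x; rewrite mule_ge0// lee_fin ltW.
Qed.

Lemma nonneg_measurable_xabs (f : X -> xcomplex R) : xmeasurable f ->
  nonneg_measurable (fun x => xabs (f x)).
Proof. by move=> mf; split; [exact: xmeasurable_xabs|move=> x; exact: xabs_ge0]. Qed.

Lemma distr_scale (r : R) u s : 0 < r ->
  distr nu (fun x => r%:E * u x)%E s = distr nu u (r^-1 * s).
Proof.
move=> r0; rewrite /distr; congr (nu _); apply/seteqP; split => x /=;
  by rewrite EFinM lte_pdivrMl.
Qed.

Lemma rearr_scale_le (r : R) u t : 0 < r ->
  (rearr nu (fun x => r%:E * u x)%E t <= r%:E * rearr nu u t)%E.
Proof.
move=> r0; rewrite -lee_pdivrMl//; apply/ereal_infP => _ [s [s0 st] <-].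
rewrite lee_pdivrMl//; apply: ereal_inf_lbound; exists (r * s) => //.
split; first by rewrite mulr_ge0// ltW.
by rewrite distr_scale// mulrA mulVf ?gt_eqF// mul1r.
Qed.

Lemma distr_le_ae u v s : measurable_fun setT u -> measurable_fun setT v ->
  {ae nu, forall x, (u x <= v x)%E} -> (distr nu u s <= distr nu v s)%E.
Proof.
move=> mu mv [B [mB B0 uvB]].
apply: (@le_trans _ _ (nu ([set x | (s%:E < v x)%E] `|` B))).
  apply: le_measure; rewrite ?inE; [exact: measurable_superlevel| |].
    by apply: measurableU => //; exact: measurable_superlevel.
  move=> x /= su; have [uv|uv] := pselect (u x <= v x)%E.
    by left; exact: lt_le_trans su uv.
  by right; exact: uvB.
by rewrite measureU0//; exact: measurable_superlevel.
Qed.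

(** Where [a + b > s], the larger of [2 a] and [2 b] exceeds s. *)
Lemma distr_add_le u (a b : X -> \bar R) s :
  measurable_fun setT u -> nonneg_measurable a -> nonneg_measurable b ->
  {ae nu, forall x, (u x <= a x + b x)%E} ->
  (distr nu u s <= distr nu (fun x => 2%:E * a x)%E s
                 + distr nu (fun x => 2%:E * b x)%E s)%E.
Proof.
move=> mu ma mb uab.
have [ma2 _] := nonneg_measurable_scale 2 a ltac:(by []) ma.
have [mb2 _] := nonneg_measurable_scale 2 b ltac:(by []) mb.
have [ma' a0] := ma; have [mb' b0] := mb.
apply: (@le_trans _ _ (distr nu (fun x => a x + b x)%E s)).
  by apply: distr_le_ae => //; exact: emeasurable_funD.
apply: (@le_trans _ _ (nu ([set x | (s%:E < 2%:E * a x)%E] `|`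
    [set x | (s%:E < 2%:E * b x)%E]))); last first.
  by apply: measureU2; exact: measurable_superlevel.
apply: le_measure; rewrite ?inE.
- by apply: measurable_superlevel; exact: emeasurable_funD.
- by apply: measurableU; exact: measurable_superlevel.
move=> x /= sab; have [ab|/ltW ba] := leP (a x) (b x).
  by right; rewrite (lt_le_trans sab)// mule_natl mule2n leeD2r.
by left; rewrite (lt_le_trans sab)// mule_natl mule2n leeD2l.
Qed.

End distribution_of_sums.

Section decomposition.
Context {R : realType} {d : measure_display} {T : measurableType d}.
Variable mu : {measure set T -> \bar R}.

(** Restrict [h] to the set [F] of [distr_splitting] and to its complement. The 4 is the 2 of the
    hypothesis times the 2 of the splitting, and [e] undoes the passage from s to [s/e]. The space
    of [h] may differ from T, so that both f and its rearrangement on the half-line can be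
    treated. *)
Lemma xadd_decomposition {d'} {X : measurableType d'} (nu : {measure set X -> \bar R})
    (h : X -> xcomplex R) (vA vB : T -> \bar R) :
  xmeasurable h -> nonneg_measurable vA -> nonneg_measurable vB ->
  (forall s, 0 < s ->
    (distr nu (fun x => xabs (h x)) s <= 2%:E * (distr mu vA s + distr mu vB s))%E) ->
  exists hA hB, [/\ xmeasurable hA, xmeasurable hB,
    forall x, h x = xadd (hA x) (hB x),
    forall s, 0 <= s -> (distr nu (fun x => xabs (hA x)) s <=
       4%:E * distr mu (fun x => (expR 1)%:E * vA x)%E s)%E &
    forall s, 0 <= s -> (distr nu (fun x => xabs (hB x)) s <=
       4%:E * distr mu (fun x => (expR 1)%:E * vB x)%E s)%E].
Proof.
move=> mh mvA mvB hv.
have H0 (v : T -> \bar R) (s : R) : 0 < s -> (0 <= 2%:E * distr mu v s)%E.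
  by move=> _; rewrite mule_ge0// distr_ge0.
have HH (v : T -> \bar R) (s t : R) : nonneg_measurable v -> 0 < s -> s <= t ->
    (2%:E * distr mu v t <= 2%:E * distr mu v s)%E.
  by move=> [mv _] s0 st; rewrite lee_pmul2l// distr_nonincreasing.
have [||||s s0|F [mF FA FB]] := distr_splitting nu _ (nonneg_measurable_xabs _ mh)
  (fun s => 2%:E * distr mu vA s)%E (fun s => 2%:E * distr mu vB s)%E.
- by move=> s t; exact: HH.
- by move=> s t; exact: HH.
- by move=> s; exact: H0.
- by move=> s; exact: H0.
- by rewrite -ge0_muleDr ?distr_ge0// hv.
have key (A : set X) (v : T -> \bar R) : measurable A -> nonneg_measurable v ->
    (forall s : R, 0 < s -> (nu (A `&` [set x | (s%:E < xabs (h x))%E]) <=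
        2%:E * (2%:E * distr mu v (expR (-1) * s)%R))%E) ->
    forall s, 0 <= s -> (distr nu (fun x => xabs (xrestrict A h x)) s <=
       4%:E * distr mu (fun x => (expR 1)%:E * v x)%E s)%E.
  move=> mA mv Av s; rewrite le_eqVlt.
  have pos (t : R) : 0 < t -> (distr nu (fun x => xabs (xrestrict A h x)) t <=
       4%:E * distr mu (fun x => (expR 1)%:E * v x)%E t)%E.
    move=> t0; rewrite distr_scale ?expR_gt0// -expRN.
    have := Av _ t0; rewrite muleA -EFinM -natrM; apply: le_trans.
    rewrite le_eqVlt; apply/orP; left; apply/eqP; congr (nu _).
    apply/seteqP; split => x /=; rewrite xabs_restrict.
      by case: ifPn => [/set_mem|_]//; rewrite lte_fin ltNge (ltW t0).
    by move=> [Ax tx]; rewrite mem_set.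
  (* The splitting only speaks of positive levels; level 0 follows by right continuity. *)
  case/predU1P => [<-|]; last exact: pos.
  apply: distr_right_continuous.
    exact: (xmeasurable_xabs _ (xmeasurable_restrict _ _ mA mh)).
  move=> e e0; rewrite add0r (le_trans (pos _ e0))// lee_pmul2l//.
  rewrite distr_nonincreasing ?(ltW e0)//.
  by have [] := nonneg_measurable_scale (expR 1) v (expR_gt0 _) mv.
exists (xrestrict F h), (xrestrict (~` F) h); split.
- exact: xmeasurable_restrict.
- by apply: xmeasurable_restrict => //; exact: measurableC.
- move=> x; rewrite /xrestrict in_setC.
  by case: (x \in F); rewrite ?xaddz0 ?xadd0z.
- exact: key.
- by apply: key => //; exact: measurableC.
Qed.

End decomposition.

Section equivalence.
Context {R : realType} {d : measure_display} {T : measurableType d}.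
Variables (mu : {measure set T -> \bar R}) (NA NB : (T -> xcomplex R) -> \bar R).
Hypotheses (HA : ri_quasi_Banach_function_norm mu NA)
  (HB : ri_quasi_Banach_function_norm mu NB).

Local Notation S := (rearranged_sum_norm mu NA NB).
Local Notation preserving := (measure_preserving_onto_range mu).

Lemma norm_xabs (N : (T -> xcomplex R) -> \bar R) f :
  ri_quasi_Banach_function_norm mu N -> xmeasurable f ->
  N f = N (embed (fun x => xabs (f x))).
Proof. by move=> [[_ _ NE] _] mf; rewrite NE. Qed.

(** A distribution bound yields a decomposition of f on T, and one of its rearrangement on the
    half-line, whose pieces are handled by [dilation]. The factor 2 in the hypothesis leaves room
    for the sums of functions in the quasi-triangle inequality. *)
Lemma sum_norms_le : exists2 C : R, 0 < C &
  forall sA sB, preserving sA -> preserving sB ->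
  forall f vA vB, xmeasurable f -> nonneg_measurable vA -> nonneg_measurable vB ->
  (forall s, 0 < s -> (distr mu (fun x => xabs (f x)) s <=
     2%:E * (distr mu vA s + distr mu vB s))%E) ->
  (sum_norm mu NA NB f <= C%:E * (NA (embed vA) + NB (embed vB)))%E /\
  (S sA sB f <= C%:E * (NA (embed vA) + NB (embed vB)))%E.
Proof.
have [CA CA0 dilA] := dilation mu NA HA 4.
have [CB CB0 dilB] := dilation mu NB HB 4.
have e0 : 0 < expR 1 :> R by exact: expR_gt0.
exists (CA * expR 1 + CB * expR 1); first by rewrite addr_gt0// mulr_gt0.
move=> sA sB msA msB f vA vB mf mvA mvB fv.
have NA0 := norm_ge0 _ _ HA _ mvA; have NB0 := norm_ge0 _ _ HB _ mvB.
have [Noo|Nfin] := eqVneq (NA (embed vA) + NB (embed vB))%E +oo%E.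
  by rewrite Noo gt0_muley ?lte_fin ?addr_gt0 ?mulr_gt0// !leey.
have [NAfin NBfin] : (NA (embed vA) < +oo)%E /\ (NB (embed vB) < +oo)%E.
  have : (NA (embed vA) + NB (embed vB) < +oo)%E by rewrite ltey.
  move=> h; split; apply: le_lt_trans h; [exact: leeDl|exact: leeDr].
have mvA' := nonneg_measurable_scale _ _ e0 mvA.
have mvB' := nonneg_measurable_scale _ _ e0 mvB.
(* Besides the estimate, finiteness is recorded: the pieces must belong to the function spaces to
   compete in the infimum. *)
have bound (C : R) (N : (T -> xcomplex R) -> \bar R) v (y : \bar R) : 0 < C ->
   ri_quasi_Banach_function_norm mu N -> nonneg_measurable v ->
   (N (embed v) < +oo)%E ->
   (y <= C%:E * N (embed (fun x => (expR 1)%:E * v x)%E))%E ->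
   (y < +oo)%E /\ (y <= (C * expR 1)%:E * N (embed v))%E.
  move=> C0 HN mv Nv; rewrite (norm_scale _ _ HN)// muleA -EFinM => yN; split => //.
  apply: (le_lt_trans yN); rewrite -[N _]fineK -?EFinM ?ltry//.
  by rewrite ge0_fin_numE// (norm_ge0 _ _ HN).
have total (yA yB : \bar R) : (yA <= (CA * expR 1)%:E * NA (embed vA))%E ->
    (yB <= (CB * expR 1)%:E * NB (embed vB))%E ->
    (yA + yB <= (CA * expR 1 + CB * expR 1)%:E * (NA (embed vA) + NB (embed vB)))%E.
  move=> hA hB; rewrite ge0_muleDr//; apply: leeD.
    by apply: le_EFinM hA => //; rewrite ?mulr_gt0// lerDl ltW// mulr_gt0.
  by apply: le_EFinM hB => //; rewrite ?mulr_gt0// lerDr ltW// mulr_gt0.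
split.
- have [fA [fB [mfA mfB fE dA dB]]] := xadd_decomposition mu mu f vA vB mf mvA mvB fv.
  have [|hA hA'] := bound CA NA vA (NA fA) CA0 HA mvA NAfin.
    rewrite (norm_xabs _ _ HA)//; apply: (dilA sA) => //.
    exact: nonneg_measurable_xabs.
  have [|hB hB'] := bound CB NB vB (NB fB) CB0 HB mvB NBfin.
    rewrite (norm_xabs _ _ HB)//; apply: (dilB sA) => //.
    exact: nonneg_measurable_xabs.
  apply: le_trans (total _ _ hA' hB'); apply: ereal_inf_lbound.
  by exists fA, fB; split => //; exact: aeW.
- have mxf := nonneg_measurable_xabs _ mf.
  (* On the half-line the function to be split is the rearrangement of f, which has the same
     distribution as f. *)
  pose h : measurableTypeR R -> xcomplex R := embed (rearrangement mu f).
  have mr : measurable_fun setT (rearrangement mu f : measurableTypeR R -> \bar R).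
    exact: (measurable_rearr mu (fun x => xabs (f x)) mxf.1).
  have mh : xmeasurable h by exact: xmeasurable_embed.
  have hE : (fun t => xabs (h t)) = rearr mu (fun x => xabs (f x)).
    by apply/funext => t; rewrite xabs_xreal gee0_abs//; exact: rearr_ge0.
  have hv s : 0 < s -> (distr (halfline_measure R) (fun t => xabs (h t)) s <=
      2%:E * (distr mu vA s + distr mu vB s))%E.
    by move=> s0; rewrite hE (distr_rearr_halfline _ _ _ mxf.1 (ltW s0)); exact: fv.
  have [gA [gB [mgA mgB gE dA dB]]] :=
    xadd_decomposition mu (halfline_measure R) h vA vB mh mvA mvB hv.
  have [|hA hA'] := bound CA NA vA (representation_norm mu NA sA gA) CA0 HA mvA NAfin.
    rewrite representation_normE//; apply: (dilA sA) => //.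
      exact: (nonneg_measurable_rearr_comp mu _ _ _ msA (xmeasurable_xabs _ mgA)).
    move=> s s0; rewrite distr_rearr_comp//; last exact: (xmeasurable_xabs _ mgA).
    by rewrite ge_min dA.
  have [|hB hB'] := bound CB NB vB (representation_norm mu NB sB gB) CB0 HB mvB NBfin.
    rewrite representation_normE//; apply: (dilB sB) => //.
      exact: (nonneg_measurable_rearr_comp mu _ _ _ msB (xmeasurable_xabs _ mgB)).
    move=> s s0; rewrite distr_rearr_comp//; last exact: (xmeasurable_xabs _ mgB).
    by rewrite ge_min dB.
  apply: le_trans (total _ _ hA' hB'); apply: ereal_inf_lbound.
  by exists gA, gB; split => //; exact: aeW.
Qed.

(** The choice is [2 |fA|] and [2 |fB|]; the doubling comes from [distr_add_le]. *)
Lemma sum_norm_summands f fA fB : xmeasurable f ->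
  xmeasurable fA -> xmeasurable fB ->
  {ae mu, forall x, f x = xadd (fA x) (fB x)} ->
  exists vA vB, [/\ nonneg_measurable vA, nonneg_measurable vB,
    forall s, 0 <= s -> (distr mu (fun x => xabs (f x)) s <=
      distr mu vA s + distr mu vB s)%E,
    NA (embed vA) = (2%:E * NA fA)%E & NB (embed vB) = (2%:E * NB fB)%E].
Proof.
move=> mf mfA mfB fE.
have mA := nonneg_measurable_xabs _ mfA; have mB := nonneg_measurable_xabs _ mfB.
exists (fun x => 2%:E * xabs (fA x))%E, (fun x => 2%:E * xabs (fB x))%E; split.
- exact: nonneg_measurable_scale.
- exact: nonneg_measurable_scale.
- move=> s s0; apply: distr_add_le => //; first exact: xmeasurable_xabs.
  by move: fE; apply: filterS => x ->; exact: xabs_xadd.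
- by rewrite (norm_xabs _ fA HA mfA) (norm_scale _ _ HA).
- by rewrite (norm_xabs _ fB HB mfB) (norm_scale _ _ HB).
Qed.

(** The half-line summands are carried to T by rearranging them and composing with [sA] and [sB],
    then doubled as in [sum_norm_summands]. *)
Lemma rearranged_sum_norm_summands sA sB f (gA gB : measurableTypeR R -> xcomplex R) :
  preserving sA -> preserving sB -> xmeasurable f ->
  xmeasurable gA -> xmeasurable gB ->
  {ae halfline_measure R, forall t,
    (rearrangement mu f t <= xabs (gA t) + xabs (gB t))%E} ->
  exists vA vB, [/\ nonneg_measurable vA, nonneg_measurable vB,
    forall s, 0 <= s -> (distr mu (fun x => xabs (f x)) s <=
      distr mu vA s + distr mu vB s)%E,
    NA (embed vA) = (2%:E * representation_norm mu NA sA gA)%E &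
    NB (embed vB) = (2%:E * representation_norm mu NB sB gB)%E].
Proof.
move=> msA msB mf mgA mgB fE; have mxf := nonneg_measurable_xabs _ mf.
have mA := nonneg_measurable_xabs _ mgA; have mB := nonneg_measurable_xabs _ mgB.
have mrA := nonneg_measurable_rearr_comp mu (halfline_measure R) _ _ msA mA.1.
have mrB := nonneg_measurable_rearr_comp mu (halfline_measure R) _ _ msB mB.1.
exists (fun x => 2%:E * rearr (halfline_measure R) (fun t => xabs (gA t)) (sA x))%E,
  (fun x => 2%:E * rearr (halfline_measure R) (fun t => xabs (gB t)) (sB x))%E; split.
- exact: nonneg_measurable_scale.
- exact: nonneg_measurable_scale.
- move=> s s0; rewrite !distr_scale//.
  have s20 : 0 <= 2^-1 * s by rewrite mulr_ge0// invr_ge0.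
  rewrite (distr_rearr_comp _ mu sA _ _ msA mA.1)//.
  rewrite (distr_rearr_comp _ mu sB _ _ msB mB.1)//.
  have := distr_add_le (halfline_measure R) (rearrangement mu f) _ _ s
    (measurable_rearr mu _ mxf.1) mA mB fE.
  rewrite (distr_rearr_halfline mu _ _ mxf.1 s0) !distr_scale// => fAB.
  have ft := distr_le_total mu (fun x => xabs (f x)) s mxf.1.
  have h0 h t := distr_ge0 (halfline_measure R) h t.
  (* If the cut at [mu T] is active in either summand, that summand equals [mu T], which already
     bounds the left side. *)
  rewrite /mine; case: ifPn => _; case: ifPn => _ //; apply: (le_trans ft).
  + by rewrite leeDr ?measure_ge0 ?h0.
  + by rewrite leeDl ?measure_ge0 ?h0.
  + by rewrite leeDl ?measure_ge0.
- by rewrite representation_normE// (norm_scale _ _ HA).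
- by rewrite representation_normE// (norm_scale _ _ HB).
Qed.

Lemma ae_rearrangement_le f (gA gB : measurableTypeR R -> xcomplex R) :
  {ae halfline_measure R, forall t,
    embed (rearrangement mu f : measurableTypeR R -> \bar R) t = xadd (gA t) (gB t)} ->
  {ae halfline_measure R, forall t,
    (rearrangement mu f t <= xabs (gA t) + xabs (gB t))%E}.
Proof.
apply: filterS => t ft; apply: le_trans (xabs_xadd _ _); rewrite -ft xabs_xreal.
by rewrite gee0_abs//; exact: rearr_ge0.
Qed.

(** A decomposition for either norm provides [vA] and [vB], which [sum_norms_le] turns into a bound
    for the other norm; then one passes to the infimum. The constant doubles because the summands
    do, and 1 is added to make it at least 1. *)
Lemma sum_norms_equivalent : exists2 C : R, 1 <= C &
  forall sA sB, preserving sA -> preserving sB -> forall f, xmeasurable f ->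
  (sum_norm mu NA NB f <= C%:E * S sA sB f)%E /\
  (S sA sB f <= C%:E * sum_norm mu NA NB f)%E.
Proof.
have [C C0 leC] := sum_norms_le; exists (C * 2 + 1); first by rewrite lerDr mulr_ge0 ?ltW.
have C1 : 0 < C * 2 + 1 by rewrite addr_gt0// mulr_gt0.
have weaken (y yA yB : \bar R) : (0 <= yA)%E -> (0 <= yB)%E ->
    (y <= C%:E * (2%:E * yA + 2%:E * yB))%E ->
    (((C * 2 + 1)^-1)%:E * y <= yA + yB)%E.
  move=> yA0 yB0; rewrite -ge0_muleDr// muleA -EFinM => yC.
  rewrite lee_pdivrMl//; apply: le_EFinM yC; rewrite ?mulr_gt0//.
    by rewrite lerDl.
  by rewrite adde_ge0.
have two u v s : (distr mu u s + distr mu v s <= 2%:E * (distr mu u s + distr mu v s))%E.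
  by rewrite mule_natl mule2n leeDl// adde_ge0 ?distr_ge0.
move=> sA sB msA msB f mf; split.
- rewrite -lee_pdivrMl//; apply/ereal_infP => _ [gA [gB [[mgA _] [mgB _] fE ->]]].
  have [vA [vB [mvA mvB fv NvA NvB]]] := rearranged_sum_norm_summands _ _ _ _ _
    msA msB mf mgA mgB (ae_rearrangement_le _ _ _ fE).
  apply: weaken.
  + rewrite representation_normE// (norm_ge0 _ _ HA)//.
    exact: (nonneg_measurable_rearr_comp mu _ _ _ msA (xmeasurable_xabs _ mgA)).
  + rewrite representation_normE// (norm_ge0 _ _ HB)//.
    exact: (nonneg_measurable_rearr_comp mu _ _ _ msB (xmeasurable_xabs _ mgB)).
  rewrite -NvA -NvB; apply: (leC sA sB msA msB f vA vB mf mvA mvB _).1 => s s0.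
  by rewrite (le_trans (fv _ (ltW s0))).
- rewrite -lee_pdivrMl//; apply/ereal_infP => _ [gA [gB [[mgA _] [mgB _] fE ->]]].
  have [vA [vB [mvA mvB fv NvA NvB]]] := sum_norm_summands _ _ _ mf mgA mgB fE.
  apply: weaken.
  + by move: HA => [[+ _ _] _]; apply.
  + by move: HB => [[+ _ _] _]; apply.
  rewrite -NvA -NvB; apply: (leC sA sB msA msB f vA vB mf mvA mvB _).2 => s s0.
  by rewrite (le_trans (fv _ (ltW s0))).
Qed.

End equivalence.

(** * Properties of the rearranged sum norm *)

(** Finite infima are approached within [e / 2] each. Nonnegativity excludes [-oo], so a single
    infinite infimum makes the right side infinite. *)
Lemma le_ereal_infD {R : realType} (x : \bar R) (A B : set (\bar R)) :
  (0 <= ereal_inf A)%E -> (0 <= ereal_inf B)%E ->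
  (forall a b, A a -> B b -> (x <= a + b)%E) ->
  (x <= ereal_inf A + ereal_inf B)%E.
Proof.
move=> A0 B0 xAB.
have [->|Aoo] := eqVneq (ereal_inf A) +oo%E.
  by rewrite addye ?leey// gt_eqF// (lt_le_trans _ B0).
have [->|Boo] := eqVneq (ereal_inf B) +oo%E.
  by rewrite addey ?leey// gt_eqF// (lt_le_trans _ A0).
have Afin : ereal_inf A \is a fin_num by rewrite ge0_fin_numE// ltey.
have Bfin : ereal_inf B \is a fin_num by rewrite ge0_fin_numE// ltey.
apply/lee_addgt0Pr => e e0; have e20 : 0 < e / 2 by rewrite divr_gt0.
have [a Aa ae] := lb_ereal_inf_adherent e20 Afin.
have [b Bb be] := lb_ereal_inf_adherent e20 Bfin.
rewrite (le_trans (xAB _ _ Aa Bb))// (le_trans (leeD (ltW ae) (ltW be)))//.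
by rewrite addeACA -EFinD -splitr.
Qed.

Section rearranged_sum_norm.
Context {R : realType} {d : measure_display} {T : measurableType d}.
Variables (mu : {measure set T -> \bar R}) (NA NB : (T -> xcomplex R) -> \bar R).
Hypotheses (HA : ri_quasi_Banach_function_norm mu NA)
  (HB : ri_quasi_Banach_function_norm mu NB).
Variables (sA sB : T -> measurableTypeR R).
Hypotheses (msA : measure_preserving_onto_range mu sA)
  (msB : measure_preserving_onto_range mu sB).
Implicit Types (f g : T -> xcomplex R) (gA gB : measurableTypeR R -> xcomplex R).

Local Notation S := (rearranged_sum_norm mu NA NB sA sB).
Local Notation hl := (halfline_measure R).

#[local] Instance ae_halfline_filter : Filter (almost_everywhere hl) :=
  ae_filter_ringOfSetsType hl.

Section one_space.
Variables (N : (T -> xcomplex R) -> \bar R) (sigma : T -> measurableTypeR R).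
Hypotheses (HN : ri_quasi_Banach_function_norm mu N)
  (ms : measure_preserving_onto_range mu sigma).

Lemma representation_norm_ge0 gA : xmeasurable gA ->
  (0 <= representation_norm mu N sigma gA)%E.
Proof.
move=> mg; rewrite representation_normE// (norm_ge0 _ _ HN)//.
exact: (nonneg_measurable_rearr_comp mu _ _ _ ms (xmeasurable_xabs _ mg)).
Qed.

Lemma representation_norm_le gA gB : xmeasurable gA -> xmeasurable gB ->
  {ae hl, forall t, (xabs (gA t) <= xabs (gB t))%E} ->
  (representation_norm mu N sigma gA <= representation_norm mu N sigma gB)%E.
Proof.
move=> mA mB AB; have mxA := xmeasurable_xabs _ mA; have mxB := xmeasurable_xabs _ mB.
rewrite !representation_normE//; have [_ [_ NL _ _ _]] := HN; apply: NL.
- exact: (measurable_rearr_comp _ _ _ _ ms mxA).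
- exact: (measurable_rearr_comp _ _ _ _ ms mxB).
apply: aeW => x; rewrite rearr_ge0/=; apply: le_rearr => s s0.
exact: distr_le_ae.
Qed.

Lemma representation_norm_scale_le (r : R) gA : 0 < r -> xmeasurable gA ->
  (representation_norm mu N sigma (embed (fun t => r%:E * xabs (gA t))%E)
    <= r%:E * representation_norm mu N sigma gA)%E.
Proof.
move=> r0 mg; have mxg := nonneg_measurable_xabs _ mg.
have mrg := nonneg_measurable_scale _ _ r0 mxg.
have mr := nonneg_measurable_rearr_comp mu hl _ _ ms mxg.1.
rewrite !representation_normE// -(norm_scale _ _ HN)//.
rewrite (_ : (fun t => _) = (fun t => r%:E * xabs (gA t))%E); last first.
  by apply/funext => t; rewrite xabs_xreal gee0_abs// mrg.2.
have [_ [_ NL _ _ _]] := HN; apply: NL.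
- exact: (measurable_rearr_comp _ _ _ _ ms mrg.1).
- exact: (nonneg_measurable_scale _ _ r0 mr).1.
by apply: aeW => x; rewrite rearr_ge0 rearr_scale_le.
Qed.

(** The bound e is the norm of s times the indicator of [{sigma < D}]. This set has measure exactly
    D, so the norm is positive, and the distribution of v dominates that of the step function. *)
Lemma norm_bounded_below (D : \bar R) (s : R) : (0 < D)%E -> (D <= mu setT)%E ->
  0 < s -> exists2 e : \bar R, (0 < e)%E & forall v, nonneg_measurable v ->
  (D <= distr mu v s)%E -> (e <= N (embed v))%E.
Proof.
move=> D0 DT s0; pose E := [set x | ((sigma x)%:E < D)%E].
have mE : measurable E.
  rewrite -[E]setTI; apply: emeasurable_fun_infty_o => //.
  by apply/measurable_EFinP; case: ms.
have muE : mu E = D by rewrite (measure_preserving_initial _ _ _ ms) ?ltW// min_l.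
pose chi x : \bar R := if x \in E then s%:E else 0%E.
have mchi : nonneg_measurable chi.
  split; first by apply: measurable_fun_ifT => //; exact: measurable_mem.
  by move=> x; rewrite /chi; case: ifP => // _; rewrite lee_fin ltW.
exists (N (embed chi)) => [|v mv Dv].
  rewrite lt_neqAle (norm_ge0 _ _ HN)// andbT; apply/eqP => /esym.
  have [_ [[_ N0 _] _ _ _ _]] := HN.
  move=> /(N0 _ (xmeasurable_embed _ mchi.1))[B [mB B0 BE]].
  have : (mu E <= mu B)%E.
    apply: le_measure; rewrite ?inE// => x Ex; apply: BE => /=.
    rewrite /embed /chi mem_set//= => -[] s00.
    by move: s0; rewrite s00 ltxx.
  by rewrite muE B0 leNgt D0.
apply: (norm_le_distr _ _ HN sigma) => // t t0.
have [st|ts] := leP s t.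
  rewrite [leLHS](_ : _ = 0%E) ?distr_ge0//.
  rewrite /distr (_ : [set _ | _] = set0) ?measure0//.
  apply/seteqP; split => // x /=; rewrite /chi; case: ifP => _.
    by rewrite lte_fin ltNge st.
  by rewrite lte_fin ltNge t0.
apply: (@le_trans _ _ D).
  rewrite -muE; apply: le_measure; rewrite ?inE//.
    by apply: measurable_superlevel; case: mchi.
  by move=> x /=; rewrite /chi; case: ifPn => [/set_mem//|_]; rewrite lte_fin ltNge t0.
by rewrite (le_trans Dv)// distr_nonincreasing ?ltW//; case: mv.
Qed.

End one_space.

(** The rearrangement w of f is cut into [min(w, |gA|)] and the excess of w over [|gA|], which is at
    most [|gB|]. No constant is lost, hence the exact monotonicity and homogeneity below. *)
Lemma rearranged_sum_norm_le f gA gB : xmeasurable f ->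
  xmeasurable gA -> xmeasurable gB ->
  {ae hl, forall t, (rearrangement mu f t <= xabs (gA t) + xabs (gB t))%E} ->
  (S f <= representation_norm mu NA sA gA + representation_norm mu NB sB gB)%E.
Proof.
move=> mf mgA mgB fAB.
have rA0 := representation_norm_ge0 _ _ HA msA _ mgA.
have rB0 := representation_norm_ge0 _ _ HB msB _ mgB.
have [->|] := eqVneq (representation_norm mu NA sA gA +
                      representation_norm mu NB sB gB)%E +oo%E; first exact: leey.
rewrite -ltey => fin.
have xA := nonneg_measurable_xabs _ mgA; have xB := nonneg_measurable_xabs _ mgB.
have mw : measurable_fun setT (rearrangement mu f : measurableTypeR R -> \bar R).
  exact: (measurable_rearr mu (fun x => xabs (f x)) (xmeasurable_xabs _ mf)).
have w0 t : (0 <= rearrangement mu f t)%E by exact: rearr_ge0.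
set w : measurableTypeR R -> \bar R := rearrangement mu f in mw.
(* The strict inequality forces [|gA|] to be finite wherever it is subtracted. *)
pose b t := (xabs (gA t) < w t)%E.
have mb : measurable_fun setT b.
  by apply: measurable_fun_lte => //; exact: xA.1.
pose hA t := if b t then xabs (gA t) else w t.
pose hB t := if b t then (w t - xabs (gA t))%E else 0%E.
have mhA : measurable_fun setT hA by apply: measurable_fun_ifT => //; exact: xA.1.
have mhB : measurable_fun setT hB.
  by apply: measurable_fun_ifT => //; apply: emeasurable_funB => //; exact: xA.1.
have hA0 t : (0 <= hA t)%E.
  by rewrite /hA; case: ifP => _; [exact: xabs_ge0|exact: w0].
have hB0 t : (0 <= hB t)%E.
  rewrite /hB; case: ifPn => // gw; rewrite sube_ge0; first exact: ltW.
  by rewrite ge0_fin_numE ?xabs_ge0// (lt_le_trans gw (leey _)).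
have wE t : embed w t = xadd (embed hA t) (embed hB t).
  rewrite [RHS]xreal_add//; congr xreal; rewrite /hA /hB.
  case: ifPn => [|_]; last by rewrite adde0.
  rewrite /b => gw; rewrite addeC subeK// ge0_fin_numE ?xabs_ge0//.
  exact: lt_le_trans gw (leey _).
have lA : (representation_norm mu NA sA (embed hA) <= representation_norm mu NA sA gA)%E.
  apply: representation_norm_le => //; first exact: xmeasurable_embed.
  apply: aeW => t; rewrite xabs_xreal gee0_abs// /hA; case: ifPn => //.
  by rewrite /b -leNgt.
have lB : (representation_norm mu NB sB (embed hB) <= representation_norm mu NB sB gB)%E.
  apply: representation_norm_le => //; first exact: xmeasurable_embed.
  apply: filterS fAB => t wt; rewrite xabs_xreal gee0_abs// /hB.
  case: ifPn => [gw|_]; last exact: xabs_ge0.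
  rewrite leeBlDl//.
  by rewrite ge0_fin_numE ?xabs_ge0//; exact: lt_le_trans gw (leey _).
apply: le_trans (leeD lA lB); apply: ereal_inf_lbound.
exists (embed hA), (embed hB); split => //; last exact: aeW.
- split; first exact: xmeasurable_embed.
  by apply: (le_lt_trans lA); apply: le_lt_trans fin; exact: leeDl.
- split; first exact: xmeasurable_embed.
  by apply: (le_lt_trans lB); apply: le_lt_trans fin; exact: leeDr.
Qed.

Lemma rearranged_sum_norm_le_distr f g : xmeasurable f -> xmeasurable g ->
  (forall s, 0 <= s -> (distr mu (fun x => xabs (f x)) s <=
                        distr mu (fun x => xabs (g x)) s)%E) ->
  (S f <= S g)%E.
Proof.
move=> mf mg fg; apply/ereal_infP => _ [gA [gB [[mgA _] [mgB _] gE ->]]].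
apply: rearranged_sum_norm_le => //.
move: (ae_rearrangement_le mu _ _ _ gE); apply: filterS => t; apply: le_trans.
exact: le_rearr.
Qed.

Lemma eq_rearranged_sum_norm f g : xmeasurable f -> xmeasurable g ->
  {ae mu, forall x, xabs (f x) = xabs (g x)} -> S f = S g.
Proof.
move=> mf mg fg; have mxf := xmeasurable_xabs _ mf; have mxg := xmeasurable_xabs _ mg.
apply/eqP; rewrite eq_le; apply/andP; split.
- apply: rearranged_sum_norm_le_distr => // s s0; apply: distr_le_ae => //.
  by move: fg; apply: filterS => x ->.
- apply: rearranged_sum_norm_le_distr => // s s0; apply: distr_le_ae => //.
  by move: fg; apply: filterS => x ->.
Qed.

Lemma rearranged_sum_norm_ge0 f : xmeasurable f -> (0 <= S f)%E.
Proof.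
move=> mf; apply/ereal_infP => _ [gA [gB [[mgA _] [mgB _] gE ->]]].
by rewrite adde_ge0// representation_norm_ge0.
Qed.

Lemma rearranged_sum_norm_functional : is_functional mu S.
Proof.
split; first exact: rearranged_sum_norm_ge0.
- move=> f g mf mg fg; apply: eq_rearranged_sum_norm => //.
  by move: fg; apply: filterS => x ->.
- move=> f mf; apply: eq_rearranged_sum_norm => //.
    by apply: xmeasurable_embed; exact: xmeasurable_xabs.
  by apply: aeW => x; rewrite xabs_xreal gee0_abs// xabs_ge0.
Qed.

Lemma rearranged_sum_norm_lattice : lattice_property mu S.
Proof.
move=> u v mu_ mv uv.
have [meu mev] := (xmeasurable_embed _ mu_, xmeasurable_embed _ mv).
apply: rearranged_sum_norm_le_distr => // s s0.
apply: distr_le_ae; [exact: xmeasurable_xabs|exact: xmeasurable_xabs|].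
move: uv; apply: filterS => x /andP[u0 uv]; rewrite !xabs_xreal !gee0_abs//.
exact: le_trans uv.
Qed.

Lemma rearranged_sum_norm_invariant : rearrangement_invariant mu S.
Proof.
move=> f g mf mg fg; rewrite /rearranged_sum_norm; congr (sum_norm _ _ _ (embed _)).
apply/funext => t; have [t0|t0] := leP 0 t; first exact: fg.
(* At negative t no level qualifies, and both sides are the infimum of the empty set. *)
rewrite /rearrangement; congr ereal_inf; apply/seteqP.
by split => _ [s [s0 st] <-]; have := le_trans (measure_ge0 mu _) st;
  rewrite lee_fin leNgt t0.
Qed.

(** If f vanishes almost everywhere, [sum_norms_le] applies with zero summands. Otherwise some level
    s is exceeded on a set of measure [2 D > 0]; in every decomposition one summand exceeds s on
    measure at least D, and [norm_bounded_below] bounds its norm uniformly. *)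
Lemma rearranged_sum_norm_zero f : xmeasurable f ->
  S f = 0%E <-> {ae mu, forall x, f x = Some 0}.
Proof.
move=> mf; have mxf := xmeasurable_xabs _ mf; split => [Sf|f0]; last first.
  have [C _ leC] := sum_norms_le mu NA NB HA HB.
  have m0 : nonneg_measurable (cst 0%E : T -> \bar R).
    by split => //; exact: measurable_cst.
  have := (leC sA sB msA msB f _ _ mf m0 m0 _).2.
  rewrite (norm0 _ _ HA) (norm0 _ _ HB) adde0 mule0 => Sf.
  apply/eqP; rewrite eq_le rearranged_sum_norm_ge0// andbT Sf// => s s0.
  rewrite mule_natl mule2n; apply: (@le_trans _ _ (distr mu (cst 0%E) s)).
    apply: distr_le_ae => //; move: f0; apply: filterS => x -> /=.
    by rewrite expr0n/= addr0 sqrtr0.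
  by rewrite -addeA leeDl// !adde_ge0// distr_ge0.
have [D0|D0] := eqVneq (distr mu (fun x => xabs (f x)) 0) 0%E.
  exists [set x | (0 < xabs (f x))%E]; split => //; first exact: measurable_superlevel.
  by move=> x /= fx; rewrite lt_neqAle xabs_ge0 andbT; apply/eqP => /esym/xabs_eq0.
exfalso.
have [s s0 Ds] : exists2 s, 0 < s & (0 < distr mu (fun x => xabs (f x)) s)%E.
  apply: contrapT => nex; move/eqP: D0; apply; apply/eqP.
  rewrite eq_le distr_ge0 andbT; apply: distr_right_continuous => // e e0.
  by rewrite leNgt add0r; apply/negP => h; apply: nex; exists e.
pose D := (2^-1%:E * distr mu (fun x => xabs (f x)) s)%E.
have Dp : (0 < D)%E by rewrite mule_gt0// lte_fin invr_gt0.
have DD : (D + D = distr mu (fun x => xabs (f x)) s)%E.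
  rewrite /D -ge0_muleDl ?lee_fin ?invr_ge0// -EFinD.
  by have -> : 2^-1 + 2^-1 = 1 :> R; [rewrite [RHS]splitr !mul1r|rewrite mul1e].
have DT : (D <= mu setT)%E.
  apply: (@le_trans _ _ (D + D)%E); first by rewrite leeDl ?ltW.
  by rewrite DD distr_le_total.
have [eA eA0 lA] := norm_bounded_below NA sA HA msA D s Dp DT s0.
have [eB eB0 lB] := norm_bounded_below NB sB HB msB D s Dp DT s0.
(* The factor 1/2 compensates the doubling in [rearranged_sum_norm_summands]. *)
have : (2^-1%:E * mine eA eB <= S f)%E.
  apply/ereal_infP => _ [gA [gB [[mgA _] [mgB _] gE ->]]].
  have rA0 := representation_norm_ge0 _ _ HA msA _ mgA.
  have rB0 := representation_norm_ge0 _ _ HB msB _ mgB.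
  have [vA [vB [mvA mvB fv NvA NvB]]] :=
    rearranged_sum_norm_summands _ _ _ HA HB _ _ _ _ _
    msA msB mf mgA mgB (ae_rearrangement_le _ _ _ _ gE).
  rewrite lee_pdivrMl// ge0_muleDr// -NvA -NvB.
  have [DA|DA] := leP D (distr mu vA s).
    rewrite (le_trans (_ : _ <= eA)%E) ?ge_min ?lexx// (le_trans (lA _ mvA DA))//.
    by rewrite leeDl// (norm_ge0 _ _ HB).
  have [DB|DB] := leP D (distr mu vB s).
    rewrite (le_trans (_ : _ <= eB)%E) ?ge_min ?lexx ?orbT// (le_trans (lB _ mvB DB))//.
    by rewrite leeDr// (norm_ge0 _ _ HA).
  by have := le_lt_trans (fv s (ltW s0)) (lteD DA DB); rewrite DD ltxx.
by rewrite Sf leNgt mule_gt0 ?lte_fin ?invr_gt0// lt_min eA0.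
Qed.

(** Multiplying both summands of a decomposition for f by r dominates the rearrangement of g. *)
Lemma rearranged_sum_norm_scale_le (r : R) f g : 0 < r ->
  xmeasurable f -> xmeasurable g -> (forall x, xabs (g x) = r%:E * xabs (f x))%E ->
  (S g <= r%:E * S f)%E.
Proof.
move=> r0 mf mg gf; rewrite -lee_pdivrMl//.
apply/ereal_infP => _ [gA [gB [[mgA _] [mgB _] gE ->]]].
have rA0 := representation_norm_ge0 _ _ HA msA _ mgA.
have rB0 := representation_norm_ge0 _ _ HB msB _ mgB.
have xA := nonneg_measurable_scale _ _ r0 (nonneg_measurable_xabs _ mgA).
have xB := nonneg_measurable_scale _ _ r0 (nonneg_measurable_xabs _ mgB).
rewrite lee_pdivrMl// ge0_muleDr//.
apply: le_trans (leeD (representation_norm_scale_le _ _ HA msA _ _ r0 mgA)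
  (representation_norm_scale_le _ _ HB msB _ _ r0 mgB)).
apply: rearranged_sum_norm_le => //.
- exact: (xmeasurable_embed _ xA.1).
- exact: (xmeasurable_embed _ xB.1).
move: (ae_rearrangement_le mu _ _ _ gE); apply: filterS => t ft.
rewrite !xabs_xreal !gee0_abs ?xA.2 ?xB.2//.
rewrite -ge0_muleDr ?xabs_ge0//; apply: (@le_trans _ _ (r%:E * rearrangement mu f t)%E).
  have := rearr_scale_le mu r (fun x => xabs (f x)) t r0.
  by rewrite (_ : (fun x => _) = (fun x => xabs (g x)))//; apply/funext => x; rewrite gf.
by rewrite lee_pmul2l.
Qed.

Lemma rearranged_sum_norm_scale (a : R[i]) u : nonneg_measurable u ->
  S (fun x => xscale a (embed u x))
  = ((ComplexField.Normc.normc a)%:E * S (embed u))%E.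
Proof.
move=> [mu_ u0]; have mf := xmeasurable_embed _ mu_.
have xg x :
    (xabs (xscale a (embed u x)) = (ComplexField.Normc.normc a)%:E * xabs (embed u x))%E.
  exact: xabs_xscale.
have mg := xmeasurable_xscale a _ mf.
have [a0|a0] := eqVneq (ComplexField.Normc.normc a) 0.
  rewrite a0 mul0e; apply/rearranged_sum_norm_zero => //.
  by apply: aeW => x; apply: xabs_eq0; rewrite xg a0 mul0e.
have r0 : 0 < ComplexField.Normc.normc a.
  by rewrite lt_neqAle eq_sym a0; case: (a) => p q /=; rewrite sqrtr_ge0.
apply/eqP; rewrite eq_le; apply/andP; split.
  exact: rearranged_sum_norm_scale_le.
(* The reverse inequality is the same lemma with the inverse factor. *)
rewrite -lee_pdivlMl//; apply: rearranged_sum_norm_scale_le => //.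
  by rewrite invr_gt0.
by move=> x; rewrite xg muleA -EFinM mulVf// mul1e.
Qed.

Lemma rearranged_sum_norm_finite : finite_on_finite_measure mu S.
Proof.
move=> E mE Efin; have [C C0 leC] := sum_norms_le mu NA NB HA HB.
pose u x : \bar R := (\1_E x)%:E.
have mu_ : nonneg_measurable u.
  split; first by apply/measurable_EFinP; exact: measurable_indic.
  by move=> x; rewrite lee_fin.
apply: le_lt_trans (leC sA sB msA msB (embed u) u u _ mu_ mu_ _).2 _.
- exact: (xmeasurable_embed _ mu_.1).
- move=> s s0; rewrite (_ : (fun x => xabs _) = u).
    by rewrite mule_natl mule2n -addeA leeDl// !adde_ge0// distr_ge0.
  by apply/funext => x; rewrite xabs_xreal gee0_abs// mu_.2.
have [_ [_ _ _ /(_ E mE Efin) Au _]] := HA.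
have [_ [_ _ _ /(_ E mE Efin) Bu _]] := HB.
have Au0 := norm_ge0 _ _ HA _ mu_; have Bu0 := norm_ge0 _ _ HB _ mu_.
rewrite -(fineK (_ : NA (embed u) \is a fin_num)) ?ge0_fin_numE//.
rewrite -(fineK (_ : NB (embed u) \is a fin_num)) ?ge0_fin_numE//.
by rewrite -EFinD -EFinM ltry.
Qed.

(** Any decompositions for u and v give summands on T. The distribution of [u + v] is bounded by
    those of [2 uA + 2 vA] and [2 uB + 2 vB], so [sum_norms_le] and the quasi-triangle inequalities
    of [NA] and [NB] conclude. *)
Lemma rearranged_sum_norm_triangle : exists K : R, 1 <= K /\
  forall u v, nonneg_measurable u -> nonneg_measurable v ->
  (S (embed (fun x => u x + v x)%E) <= K%:E * (S (embed u) + S (embed v)))%E.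
Proof.
have [C C0 leC] := sum_norms_le mu NA NB HA HB.
have [_ [[_ _ [KA [KA1 triA]]] _ _ _ _]] := HA.
have [_ [[_ _ [KB [KB1 triB]]] _ _ _ _]] := HB.
have KA0 : 0 < KA by rewrite (lt_le_trans _ KA1).
have KB0 : 0 < KB by rewrite (lt_le_trans _ KB1).
(* In the 4, one 2 comes from splitting [u + v] and one from the doubled summands; the 1 ensures
   [1 <= K]. *)
pose K := C * (KA + KB) * 4 + 1.
have K0 : 0 < C * (KA + KB) * 4 by rewrite !mulr_gt0// addr_gt0.
have K1 : 0 < K by rewrite addr_gt0.
exists K; split => [|u v mu_ mv]; first by rewrite lerDr ltW.
have muv : nonneg_measurable (fun x => u x + v x)%E.
  split; first by apply: emeasurable_funD; [case: mu_|case: mv].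
  by move=> x; rewrite adde_ge0 ?mu_.2 ?mv.2.
have xE (w : T -> \bar R) : nonneg_measurable w -> (fun x => xabs (embed w x)) = w.
  by move=> mw; apply/funext => x; rewrite xabs_xreal gee0_abs// mw.2.
have meu := xmeasurable_embed _ mu_.1; have mev := xmeasurable_embed _ mv.1.
rewrite -lee_pdivrMl//; apply: le_ereal_infD.
- exact: (rearranged_sum_norm_ge0 _ meu).
- exact: (rearranged_sum_norm_ge0 _ mev).
move=> _ _ [gA [gB [[mgA _] [mgB _] gE ->]]] [hA [hB [[mhA _] [mhB _] hE ->]]].
have [uA [uB [muA muB duv NuA NuB]]] :=
    rearranged_sum_norm_summands _ _ _ HA HB _ _ _ _ _
    msA msB meu mgA mgB (ae_rearrangement_le _ _ _ _ gE).
have [vA [vB [mvA mvB dv NvA NvB]]] :=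
    rearranged_sum_norm_summands _ _ _ HA HB _ _ _ _ _
    msA msB mev mhA mhB (ae_rearrangement_le _ _ _ _ hE).
have gA0 := representation_norm_ge0 _ _ HA msA _ mgA.
have gB0 := representation_norm_ge0 _ _ HB msB _ mgB.
have hA0 := representation_norm_ge0 _ _ HA msA _ mhA.
have hB0 := representation_norm_ge0 _ _ HB msB _ mhB.
have two : 0 < 2 :> R by [].
have scale2 (w : T -> \bar R) : nonneg_measurable w ->
    nonneg_measurable (fun x => 2%:E * w x)%E.
  exact: nonneg_measurable_scale.
have sum2 (w z : T -> \bar R) : nonneg_measurable w -> nonneg_measurable z ->
    nonneg_measurable (fun x => 2%:E * w x + 2%:E * z x)%E.
  move=> mw mz; split.
    by apply: emeasurable_funD; [case: (scale2 _ mw)|case: (scale2 _ mz)].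
  by move=> x; rewrite adde_ge0 ?(scale2 _ mw).2 ?(scale2 _ mz).2.
have distr_sum (w z : T -> \bar R) s : nonneg_measurable w -> nonneg_measurable z ->
    (distr mu (fun x => 2%:E * w x)%E s + distr mu (fun x => 2%:E * z x)%E s
      <= 2%:E * distr mu (fun x => 2%:E * w x + 2%:E * z x)%E s)%E.
  move=> mw mz; have [mw2 w20] := scale2 _ mw; have [mz2 z20] := scale2 _ mz.
  have [mwz _] := sum2 _ _ mw mz.
  rewrite mule_natl mule2n; apply: leeD; apply: le_distr => // x.
    by rewrite leeDl.
  by rewrite leeDr.
have SC := (leC sA sB msA msB (embed (fun x => u x + v x)%E) _ _
  (xmeasurable_embed _ muv.1) (sum2 _ _ muA mvA) (sum2 _ _ muB mvB) _).2.
rewrite lee_pdivrMl//; apply: (le_trans (SC _)).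
  move=> s s0; rewrite (xE _ muv).
  apply: (@le_trans _ _ (distr mu (fun x => 2%:E * u x)%E s +
    distr mu (fun x => 2%:E * v x)%E s)%E).
    by apply: distr_add_le => //; [case: muv|exact: aeW].
  rewrite ge0_muleDr ?distr_ge0//.
  apply: le_trans (leeD (distr_sum _ _ s muA mvA) (distr_sum _ _ s muB mvB)).
  rewrite addeACA !(distr_scale mu _ _ _ two).
  have s20 : 0 <= 2^-1 * s by rewrite mulr_ge0// ltW.
  have := duv _ s20; have := dv _ s20; rewrite (xE _ mu_) (xE _ mv) => ? ?.
  exact: leeD.
have NA2 : (NA (embed (fun x => 2%:E * uA x + 2%:E * vA x)%E) <=
    KA%:E * (4%:E * (representation_norm mu NA sA gA +
      representation_norm mu NA sA hA)))%E.
  apply: (le_trans (triA _ _ (scale2 _ muA) (scale2 _ mvA))).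
  rewrite !(norm_scale _ _ HA)// NuA NvA !muleA -!EFinM -!ge0_muleDr//.
  by rewrite -natrM muleA -EFinM.
have NB2 : (NB (embed (fun x => 2%:E * uB x + 2%:E * vB x)%E) <=
    KB%:E * (4%:E * (representation_norm mu NB sB gB +
      representation_norm mu NB sB hB)))%E.
  apply: (le_trans (triB _ _ (scale2 _ muB) (scale2 _ mvB))).
  rewrite !(norm_scale _ _ HB)// NuB NvB !muleA -!EFinM -!ge0_muleDr//.
  by rewrite -natrM muleA -EFinM.
rewrite addeACA.
set a := (representation_norm mu NA sA gA + _)%E in NA2 *.
set b := (representation_norm mu NB sB gB + _)%E in NB2 *.
have a0 : (0 <= a)%E by rewrite adde_ge0.
have b0 : (0 <= b)%E by rewrite adde_ge0.
apply: (@le_trans _ _ (C%:E * ((KA + KB)%:E * (4%:E * (a + b))))%E).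
  rewrite lee_pmul2l ?lte_fin// [in leRHS](ge0_muleDr 4%:E)// ge0_muleDr ?mule_ge0//.
  apply: leeD; [apply: le_EFinM NA2 => //|apply: le_EFinM NB2 => //];
    by rewrite ?mule_ge0// ?lerDl ?lerDr ltW.
rewrite !muleA -!EFinM lee_wpmul2r ?adde_ge0// lee_fin /K.
by rewrite ?mulrA lerDl.
Qed.

End rearranged_sum_norm.

(** * Transfer of the local L^1 property between equivalent norms *)

Section local_L1.
Context {R : realType} {d : measure_display} {T : measurableType d}.
Variable mu : {measure set T -> \bar R}.

Lemma local_L1_dominated (N N' : (T -> xcomplex R) -> \bar R) (C : R) : 0 <= C ->
  (forall f, xmeasurable f -> (0 <= N f)%E) ->
  (forall f, xmeasurable f -> (N f <= C%:E * N' f)%E) ->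
  local_L1_property mu N -> local_L1_property mu N'.
Proof.
move=> C0 N0 NN' LN E mE Efin; have [c cE] := LN E mE Efin.
(* The given constant [c] may be negative, and its absolute value allows the domination to be
   multiplied through. *)
exists (`|c| * C) => u mu_; have mf := xmeasurable_embed _ mu_.1.
apply: (le_trans (cE u mu_)); apply: (@le_trans _ _ (`|c|%:E * N (embed u))%E).
  by rewrite lee_wpmul2r ?N0// lee_fin ler_norm.
by rewrite EFinM -muleA lee_wpmul2l ?lee_fin ?NN'.
Qed.

Lemma sum_norm_ge0 (NA NB : (T -> xcomplex R) -> \bar R) f :
  ri_quasi_Banach_function_norm mu NA -> ri_quasi_Banach_function_norm mu NB ->
  (0 <= sum_norm mu NA NB f)%E.
Proof.
move=> [[A0 _ _] _] [[B0 _ _] _].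
apply/ereal_infP => _ [gA [gB [[mgA _] [mgB _] _ ->]]].
by rewrite adde_ge0 ?A0 ?B0.
Qed.

End local_L1.

Theorem theorem2p1 (R : realType) (d : measure_display) (T : measurableType d)
    (mu : {sigma_finite_measure set T -> \bar R})
    (NA NB : (T -> xcomplex R) -> \bar R) :
  non_atomic mu ->
  ri_quasi_Banach_function_norm mu NA ->
  ri_quasi_Banach_function_norm mu NB ->
  (exists c C : R, 0 < c /\ c <= C /\
     forall sA sB : T -> measurableTypeR R,
       measure_preserving_onto_range mu sA ->
       measure_preserving_onto_range mu sB ->
       forall f : T -> xcomplex R, xmeasurable f ->
         (c%:E * rearranged_sum_norm mu NA NB sA sB f <= sum_norm mu NA NB f)%E /\
         (sum_norm mu NA NB f <= C%:E * rearranged_sum_norm mu NA NB sA sB f)%E) /\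
  (forall sA sB : T -> measurableTypeR R,
     measure_preserving_onto_range mu sA ->
     measure_preserving_onto_range mu sB ->
     let S := rearranged_sum_norm mu NA NB sA sB in
     is_functional mu S /\ is_quasinorm mu S /\ lattice_property mu S /\
     finite_on_finite_measure mu S /\ rearrangement_invariant mu S /\
     (local_L1_property mu S <-> local_L1_property mu (sum_norm mu NA NB))).
Proof.
move=> _ HA HB; have [C C1 SC] := sum_norms_equivalent mu NA NB HA HB.
have C0 : 0 < C by rewrite (lt_le_trans _ C1).
split.
  (* One constant serves both bounds, and [1 <= C] orders it after its inverse. *)
  exists C^-1, C; split; first by rewrite invr_gt0.
  split; first by rewrite (le_trans _ C1)// invf_le1.
  move=> sA sB msA msB f mf; have [SC1 SC2] := SC sA sB msA msB f mf.
  by split => //; rewrite lee_pdivrMl.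
move=> sA sB msA msB S; split; first exact: rearranged_sum_norm_functional.
split.
  split.
  - exact: rearranged_sum_norm_scale.
  - exact: rearranged_sum_norm_zero.
  - exact: rearranged_sum_norm_triangle.
split; first exact: rearranged_sum_norm_lattice.
split; first exact: rearranged_sum_norm_finite.
split; first exact: rearranged_sum_norm_invariant.
split; apply: (local_L1_dominated _ _ _ C); rewrite ?(ltW C0)//.
- by move=> f; exact: rearranged_sum_norm_ge0.
- by move=> f mf; have [] := SC sA sB msA msB f mf.
- by move=> f _; exact: sum_norm_ge0.
- by move=> f mf; have [] := SC sA sB msA msB f mf.
Qed.
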